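(* Let $M$ and $N$ be finitely generated modules over a Dedekind domain $R$; let $X:=\operatorname{Ass}(N)-\{0\}$; and let $t$ be a positive integer. Then $\operatorname{spl}(M,N)\geqslant t$ if and only if $\operatorname{spl}(M_{\mathfrak m},N_{\mathfrak m})\geqslant t$ for every $\mathfrak m\in X$ and one of the following conditions holds: (1) $\operatorname{rank}(N)=0$. (2) $\operatorname{rank}(M)\geqslant 1+t\cdot\operatorname{rank}(N)$. (3) $\operatorname{rank}(M)=t\cdot\operatorname{rank}(N)\geqslant t$, and $[M]=[N]^t$. Moreover, if $\operatorname{spl}(M,N)\geqslant t$ and (3) holds, then $\operatorname{spl}(\operatorname{Tor}(M),\operatorname{Tor}(N))\geqslant t$, and $\operatorname{spl}(M,N)=t$.
   Context: A Dedekind domain is an integral domain in which every ideal is projective (so a field is a Dedekind domain). For a commutative ring $A$ and $A$-modules $P,Q$, $\operatorname{spl}_A(P,Q)$ is the supremum (possibly $\infty$) of the nonnegative integers $t$ such that there exists a split surjective $A$-linear map $P\to Q^{\oplus t}$ (a surjection having an $A$-linear right inverse). Subscripts are omitted: $\operatorname{spl}(M,N)=\operatorname{spl}_R(M,N)$, $\operatorname{spl}(M_{\mathfrak m},N_{\mathfrak m})=\operatorname{spl}_{R_{\mathfrak m}}(M_{\mathfrak m},N_{\mathfrak m})$, $\operatorname{Ass}(N)=\operatorname{Ass}_R(N)$ (the set of associated primes of $N$; the zero ideal is removed from it to form $X$). $\operatorname{Tor}(M)$ denotes the torsion submodule of $M$, and $\operatorname{rank}(M)$ is the dimension of $M\otimes_R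 K$ over the fraction field $K$ of $R$. $\operatorname{Pic}(R)$ is the class group of $R$: nonzero fractional ideals modulo the relation $I\sim J$ iff $aI=bJ$ for some nonzero $a,b\in R$, with multiplication $[I][J]=[IJ]$ and identity $[R]$. If $M\neq\operatorname{Tor}(M)$ and $r=\operatorname{rank}(M)$, then $M/\operatorname{Tor}(M)\cong R^{\oplus(r-1)}\oplus I$ for a nonzero ideal $I$ of $R$, unique up to isomorphism; the class $[I]\in\operatorname{Pic}(R)$ is called the Steinitz class of $M$ and is denoted $[M]$. *)

(* Defs.v *)
From HB Require Import structures.
From mathcomp Require Import all_boot all_order all_algebra.
From mathcomp Require Import generic_quotient ring_quotient fraction.
From mathcomp Require Import boolp classical_sets constructive_ereal.
From mathcomp Require Import ring.
Set Implicit Arguments.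
Unset Strict Implicit.
Unset Printing Implicit Defensive.
Import Order.TTheory GRing.Theory Num.Theory.
Local Open Scope ring_scope.
Local Open Scope quotient_scope.
Local Open Scope classical_set_scope.

Notation "x %:F" := (@FracField.tofrac _ x) : ring_scope.

(* A submodule is a term of [submodClosed V]; in particular an ideal of R is a
   term of [submodClosed R^o].  These are Boolean predicates, which classically
   is no restriction. *)

Section SubModule.
Variables (R : pzRingType) (V : lmodType R) (S : submodClosed V).

Record submodule : Type :=
  Submodule { submodule_val :> V; submodule_mem : submodule_val \in S }.

HB.instance Definition _ := [isSub for submodule_val].
HB.instance Definition _ := [Choice of submodule by <:].
HB.instance Definition _ := [SubChoice_isSubLmodule of submodule by <:].

(* The library only builds quotients by a [zmodClosed] predicate. *)
Definition submodule_pred (x : V) : bool := x \in S.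

Fact submodule_pred_zmod_closed : zmod_closed submodule_pred.
Proof.
split=> [|x y xS yS]; first exact: rpred0.
by rewrite -scaleN1r; exact: (rpredD (xS : x \in S) (rpredZ (- 1) (yS : y \in S))).
Qed.

HB.instance Definition _ :=
  GRing.isZmodClosed.Build V submodule_pred submodule_pred_zmod_closed.

Definition submodule_zmodClosed := GRing.ZmodClosed.clone V submodule_pred _.

Local Notation quotS := (Quotient.quot submodule_zmodClosed).

Definition quotmodule : Type := quotS.

HB.instance Definition _ := GRing.Zmodule.on quotmodule.

Definition quotmodule_scale (a : R) (x : quotmodule) : quotmodule :=
  \pi_quotS (a *: repr (x : quotS)).

Fact quotmodule_scale_pi (a : R) (x : V) :
  quotmodule_scale a (\pi_quotS x) = \pi_quotS (a *: x).
Proof.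
apply/eqP; rewrite /quotmodule_scale -Quotient.idealrBE -scalerBr.
have : repr (\pi_quotS x) - x \in submodule_zmodClosed.
  by rewrite Quotient.idealrBE reprK.
exact: (@rpredZ R V S).
Qed.

Fact quotmodule_pi_add (x y : V) :
  \pi_quotS (x + y) = (\pi_quotS x : quotmodule) + \pi_quotS y.
Proof. exact: Quotient.pi_add. Qed.

Fact quotmodule_scalerA (a b : R) (x : quotmodule) :
  quotmodule_scale a (quotmodule_scale b x) = quotmodule_scale (a * b) x.
Proof.
by elim/(@quotW _ quotS): x => x; rewrite !quotmodule_scale_pi scalerA.
Qed.

Fact quotmodule_scale1r : left_id 1 quotmodule_scale.
Proof. by elim/(@quotW _ quotS)=> x; rewrite quotmodule_scale_pi scale1r. Qed.

Fact quotmodule_scalerDr : right_distributive quotmodule_scale +%R.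
Proof.
move=> a; elim/(@quotW _ quotS)=> x; elim/quotW=> y.
by rewrite -quotmodule_pi_add !quotmodule_scale_pi scalerDr quotmodule_pi_add.
Qed.

Fact quotmodule_scalerDl (x : quotmodule) :
  {morph quotmodule_scale^~ x : a b / a + b}.
Proof.
elim/(@quotW _ quotS): x => x a b /=.
by rewrite !quotmodule_scale_pi scalerDl quotmodule_pi_add.
Qed.

HB.instance Definition _ := GRing.Zmodule_isLmodule.Build R quotmodule
  quotmodule_scalerA quotmodule_scale1r quotmodule_scalerDr
  quotmodule_scalerDl.

End SubModule.

Section Modules.
Variable (R : pzRingType).

Definition finitely_generated (V : lmodType R) : Prop :=
  exists (n : nat) (g : 'I_n -> V), forall v,
    exists c : 'I_n -> R, v = \sum_(i < n) c i *: g i.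

Definition isomorphic (U V : lmodType R) : Prop :=
  exists f : {linear U -> V}, bijective f.

Definition projective (P : lmodType R) : Prop :=
  forall (U V : lmodType R) (f : {linear U -> V}) (g : {linear P -> V}),
    (forall v, exists u, f u = v) ->
    exists h : {linear P -> U}, forall x, f (h x) = g x.

(* Surjectivity of [f] follows from the existence of the right inverse. *)
Definition split_surjection (U V : lmodType R) (f : {linear U -> V}) : Prop :=
  exists g : {linear V -> U}, cancel g f.

(* [\bar int] contains the nonnegative integers and infinity; the set below
   contains 0, hence its supremum is a nonnegative integer or +oo. *)
Definition spl (P Q : lmodType R) : \bar int :=
  supremum 0%E [set (t%:Z)%:E | t in [set t : nat |
    exists f : {linear P -> {ffun 'I_t -> Q}}, split_surjection f]].

End Modules.

Definition dedekind (R : idomainType) : Prop :=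
  forall I : submodClosed R^o, projective (submodule I).

Definition Ass (R : comNzRingType) (N : lmodType R) (p : prime_idealr R) : Prop :=
  exists x : N, forall a : R, (a \in p) = (a *: x == 0).

Section Localization.
Variables (R : comNzRingType) (S : mulrClosed R).

Record denominator : Type := Denominator { den :> R; den_mem : den \in S }.
HB.instance Definition _ := [isSub for den].
HB.instance Definition _ := [Choice of denominator by <:].

Definition denominator1 : denominator := Denominator (rpred1 S).
Definition denominatorM (s t : denominator) : denominator :=
  Denominator (rpredM (den_mem s) (den_mem t)).

Section LocModule.
Variable (M : lmodType R).

Definition loc_equiv (x y : M * denominator) : bool :=
  `[< exists u : denominator,
        (den u * den y.2) *: x.1 = (den u * den x.2) *: y.1 >].

Fact loc_equiv_is_equiv : equiv_class_of loc_equiv.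
Proof.
split=> [x|x y|y x z].
- by apply/asboolP; exists denominator1.
- by apply/asboolP/asboolP=> -[u uE]; exists u.
move=> /asboolP[u uE] /asboolP[v vE]; apply/asboolP.
exists (denominatorM (denominatorM u v) y.2) => /=.
transitivity ((den v * den z.2) *: ((den u * den y.2) *: x.1)).
  by rewrite scalerA; congr (_ *: _); ring.
rewrite uE scalerA.
transitivity ((den u * den x.2) *: ((den v * den z.2) *: y.1)).
  by rewrite scalerA; congr (_ *: _); ring.
by rewrite vE scalerA; congr (_ *: _); ring.
Qed.

Canonical loc_equiv_equiv := EquivRelPack loc_equiv_is_equiv.
Canonical loc_equiv_encModRel := defaultEncModRel loc_equiv.

Definition locmod : Type := {eq_quot loc_equiv}.
HB.instance Definition _ : EqQuotient _ loc_equiv locmod :=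
  EqQuotient.on locmod.
HB.instance Definition _ := Choice.on locmod.

Definition locfrac (x : M) (s : denominator) : locmod := \pi_locmod (x, s).

Fact locfracP (x y : M) (s t : denominator) :
  locfrac x s = locfrac y t <->
  exists u : denominator, (den u * den t) *: x = (den u * den s) *: y.
Proof.
by split=> [/eqmodP/asboolP | h]; last by apply/eqmodP/asboolP.
Qed.

Fact locfracW (P : locmod -> Prop) :
  (forall x s, P (locfrac x s)) -> forall z, P z.
Proof. by move=> h; elim/quotW=> -[x s]; exact: h. Qed.

Fact locfrac_repr (x : M) (s : denominator) :
  exists u : denominator,
    (den u * den s) *: (repr (locfrac x s)).1 =
    (den u * den (repr (locfrac x s)).2) *: x.
Proof.
by apply/locfracP; rewrite /locfrac -surjective_pairing reprK.
Qed.

Definition loc_add (z w : locmod) : locmod :=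
  locfrac (den (repr w).2 *: (repr z).1 + den (repr z).2 *: (repr w).1)
          (denominatorM (repr z).2 (repr w).2).
Definition loc_opp (z : locmod) : locmod := locfrac (- (repr z).1) (repr z).2.

Fact loc_addE (x y : M) (s t : denominator) :
  loc_add (locfrac x s) (locfrac y t) =
  locfrac (den t *: x + den s *: y) (denominatorM s t).
Proof.
rewrite /loc_add.
have [u] := locfrac_repr x s; have [v] := locfrac_repr y t.
move: (repr (locfrac x s)) (repr (locfrac y t)) => [x' s'] [y' t'] /= vE uE.
apply/locfracP; exists (denominatorM u v) => /=.
rewrite !scalerDr !scalerA; congr (_ + _).
  transitivity ((den v * den t * den t') *: ((den u * den s) *: x')).
    by rewrite scalerA; congr (_ *: _); ring.
  by rewrite uE scalerA; congr (_ *: _); ring.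
transitivity ((den u * den s * den s') *: ((den v * den t) *: y')).
  by rewrite scalerA; congr (_ *: _); ring.
by rewrite vE scalerA; congr (_ *: _); ring.
Qed.

Fact loc_oppE (x : M) (s : denominator) :
  loc_opp (locfrac x s) = locfrac (- x) s.
Proof.
rewrite /loc_opp; have [u uE] := locfrac_repr x s.
by apply/locfracP; exists u; rewrite !scalerN uE.
Qed.

Fact loc_addA : associative loc_add.
Proof.
elim/locfracW=> x s; elim/locfracW=> y t; elim/locfracW=> z w.
rewrite !loc_addE; apply/locfracP; exists denominator1 => /=.
rewrite !scalerDr !scalerA -addrA.
by congr (_ *: _ + (_ *: _ + _ *: _)); ring.
Qed.

Fact loc_addC : commutative loc_add.
Proof.
elim/locfracW=> x s; elim/locfracW=> y t.
rewrite !loc_addE addrC; congr locfrac.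
by apply/val_inj; rewrite /= mulrC.
Qed.

Fact loc_add0 : left_id (locfrac 0 denominator1) loc_add.
Proof.
elim/locfracW=> x s; rewrite loc_addE scaler0 add0r scale1r; congr locfrac.
by apply/val_inj; rewrite /= mul1r.
Qed.

Fact loc_addN : left_inverse (locfrac 0 denominator1) loc_opp loc_add.
Proof.
elim/locfracW=> x s; rewrite loc_oppE loc_addE scalerN addNr.
by apply/locfracP; exists denominator1; rewrite !scaler0.
Qed.

HB.instance Definition _ :=
  GRing.isZmodule.Build locmod loc_addA loc_addC loc_add0 loc_addN.

Fact locfracD (x y : M) (s t : denominator) :
  locfrac x s + locfrac y t =
  locfrac (den t *: x + den s *: y) (denominatorM s t).
Proof. exact: loc_addE. Qed.

End LocModule.

Section LocAct.
Variable (M : lmodType R).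

(* The action of S^-1 R on S^-1 M, and for M = R^o the product of S^-1 R. *)
Definition loc_act (a : locmod R^o) (z : locmod M) : locmod M :=
  locfrac ((repr a).1 *: (repr z).1) (denominatorM (repr a).2 (repr z).2).

Fact loc_actE (a : R^o) (x : M) (s t : denominator) :
  loc_act (locfrac a s) (locfrac x t) = locfrac (a *: x) (denominatorM s t).
Proof.
rewrite /loc_act.
have [u] := locfrac_repr a s; have [v] := locfrac_repr x t.
move: (repr (locfrac a s)) (repr (locfrac x t)) => [a' s'] [x' t'] /= vE uE.
have {}uE : den u * den s * a' = den u * den s' * a by exact: uE.
apply/locfracP; exists (denominatorM u v) => /=; rewrite !scalerA.
transitivity ((den u * den s * a') *: ((den v * den t) *: x')).
  by rewrite scalerA; congr (_ *: _); ring.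
by rewrite uE vE scalerA; congr (_ *: _); ring.
Qed.

Fact loc_act1 : left_id (locfrac (1 : R^o) denominator1) loc_act.
Proof.
elim/locfracW=> x s; rewrite loc_actE scale1r; congr locfrac.
by apply/val_inj; rewrite /= mul1r.
Qed.

Fact loc_actDr : right_distributive loc_act +%R.
Proof.
elim/locfracW=> a s; elim/locfracW=> x t; elim/locfracW=> y w.
rewrite locfracD !loc_actE locfracD.
apply/locfracP; exists denominator1 => /=; rewrite !scalerDr !scalerA.
by congr (_ *: _ + _ *: _); ring.
Qed.

Fact loc_actDl (z : locmod M) : {morph loc_act^~ z : a b / a + b}.
Proof.
elim/locfracW: z => x w; elim/locfracW=> a s; elim/locfracW=> b t.
rewrite locfracD !loc_actE locfracD.
apply/locfracP; exists denominator1 => /=.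
rewrite !scalerDr !scalerA -!scalerDl; congr (_ *: _).
have -> : den t *: a + den s *: b = (den t * (a : R) + den s * (b : R) : R) by [].
move: (a : R) (b : R) => {}a {}b; ring.
Qed.

End LocAct.

Fact loc_actA (M : lmodType R) (a b : locmod R^o) (z : locmod M) :
  loc_act a (loc_act b z) = loc_act (loc_act a b) z.
Proof.
elim/locfracW: z => x w; elim/locfracW: a => a s; elim/locfracW: b => b t.
rewrite (loc_actE b x t w) (loc_actE a _ s _) (loc_actE a b s t) loc_actE.
congr locfrac; first exact: scalerA.
by apply/val_inj; rewrite /= mulrA.
Qed.

Fact loc_actC : commutative (@loc_act R^o).
Proof.
elim/locfracW=> a s; elim/locfracW=> b t; rewrite !loc_actE.
congr locfrac; first exact: mulrC.
by apply/val_inj; rewrite /= mulrC.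
Qed.

Definition locring : Type := locmod R^o.
HB.instance Definition _ := GRing.Zmodule.on locring.
HB.instance Definition _ := GRing.Zmodule_isComPzRing.Build locring
  (@loc_actA R^o) loc_actC (@loc_act1 R^o) (fun a b z => @loc_actDl R^o z a b).

HB.instance Definition _ (M : lmodType R) :=
  GRing.Zmodule_isLmodule.Build locring (locmod M)
    (@loc_actA M) (@loc_act1 M) (@loc_actDr M) (@loc_actDl M).

End Localization.

Section LocalizationAtPrime.
Variables (R : comNzRingType) (p : prime_idealr R).

Definition primeC (x : R) : bool := x \notin p.

Fact primeC_closed : mulr_closed primeC.
Proof.
split=> [|x y xp yp]; first by change (1 \notin p); rewrite idealr1.
change (x * y \notin p); rewrite prime_idealrM negb_or.
exact/andP.
Qed.

HB.instance Definition _ := GRing.isMulClosed.Build R primeC primeC_closed.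

Definition primeC_mulrClosed := GRing.MulClosed.clone R primeC _.

Definition locring_at : comPzRingType := locring primeC_mulrClosed.
Definition locmod_at (M : lmodType R) : lmodType locring_at := locmod primeC_mulrClosed M.

End LocalizationAtPrime.

Section BaseChange.
Variables (R A : comNzRingType) (f : {rmorphism R -> A}) (M : lmodType R).

Definition balanced (V : zmodType) (b : M -> A -> V) : Prop :=
  [/\ forall a, {morph b^~ a : x y / x + y},
      forall x, {morph b x : a c / a + c} &
      forall r x a, b (r *: x) a = b x (f r * a)].

Definition balanced_sum (V : zmodType) (b : M -> A -> V) (s : seq (M * A)) : V :=
  \sum_(p <- s) b p.1 p.2.

(* A list of pairs (x_i, a_i) stands for the tensor sum_i x_i (x) a_i of
   M (x)_R A, where A is an R-algebra through f.  By the universal property of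
   the tensor product, two such sums are equal iff every R-balanced map takes
   the same value on them. *)
Definition tensor_equiv (s t : seq (M * A)) : bool :=
  `[< forall (V : zmodType) (b : M -> A -> V), balanced b ->
        balanced_sum b s = balanced_sum b t >].

Fact tensor_equiv_is_equiv : equiv_class_of tensor_equiv.
Proof.
split=> [s|s t|t s u].
- exact/asboolP.
- by apply/asboolP/asboolP=> h V b bb; rewrite h.
move=> /asboolP h /asboolP h'; apply/asboolP=> V b bb.
by rewrite h // h'.
Qed.

Canonical tensor_equiv_equiv := EquivRelPack tensor_equiv_is_equiv.
Canonical tensor_equiv_encModRel := defaultEncModRel tensor_equiv.

Definition base_change : Type := {eq_quot tensor_equiv}.
HB.instance Definition _ : EqQuotient _ tensor_equiv base_change :=
  EqQuotient.on base_change.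
HB.instance Definition _ := Choice.on base_change.

Definition tensors (s : seq (M * A)) : base_change := \pi_base_change s.

Fact tensorsP (s t : seq (M * A)) :
  tensors s = tensors t <->
  forall (V : zmodType) (b : M -> A -> V), balanced b ->
    balanced_sum b s = balanced_sum b t.
Proof.
by split=> [/eqmodP/asboolP | h]; last by apply/eqmodP/asboolP.
Qed.

Fact tensorsW (P : base_change -> Prop) :
  (forall s, P (tensors s)) -> forall z, P z.
Proof. by move=> h; elim/quotW=> s; exact: h. Qed.

Fact balanced_sum_repr (V : zmodType) (b : M -> A -> V) (s : seq (M * A)) :
  balanced b -> balanced_sum b (repr (tensors s)) = balanced_sum b s.
Proof. by apply/(tensorsP _ _).1; rewrite /tensors reprK. Qed.

Definition tensors_opp (s : seq (M * A)) := [seq (- p.1, p.2) | p <- s].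
Definition tensors_scale (a : A) (s : seq (M * A)) :=
  [seq (p.1, a * p.2) | p <- s].

Fact balanced_cat (V : zmodType) (b : M -> A -> V) (s t : seq (M * A)) :
  balanced_sum b (s ++ t) = balanced_sum b s + balanced_sum b t.
Proof. exact: big_cat. Qed.

Fact balanced_opp (V : zmodType) (b : M -> A -> V) (s : seq (M * A)) :
  balanced b -> balanced_sum b (tensors_opp s) = - balanced_sum b s.
Proof.
case=> bD _ _; rewrite /balanced_sum big_map -sumrN; apply: eq_bigr => p _ /=.
by apply: (addIr (b p.1 p.2)); rewrite -bD !addNr -(addrK (b 0 p.2) (b 0 p.2))
  -bD addr0 subrr.
Qed.

Definition scale_map (V : zmodType) (b : M -> A -> V) (a : A) (x : M) (c : A) :=
  b x (a * c).

Fact balanced_scale_map (V : zmodType) (b : M -> A -> V) (a : A) :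
  balanced b -> balanced (scale_map b a).
Proof.
rewrite /scale_map => -[b1 b2 b3]; split=> [c x y|x c d|r x c].
- exact: b1.
- by rewrite mulrDr b2.
by rewrite b3 mulrCA.
Qed.

Fact balanced_scale (V : zmodType) (b : M -> A -> V) (a : A) (s : seq (M * A)) :
  balanced_sum b (tensors_scale a s) = balanced_sum (scale_map b a) s.
Proof. by rewrite /balanced_sum big_map. Qed.

Definition base_change_add (z w : base_change) : base_change :=
  tensors (repr z ++ repr w).
Definition base_change_opp (z : base_change) : base_change :=
  tensors (tensors_opp (repr z)).
Definition base_change_scale (a : A) (z : base_change) : base_change :=
  tensors (tensors_scale a (repr z)).

Fact base_change_addE (s t : seq (M * A)) :
  base_change_add (tensors s) (tensors t) = tensors (s ++ t).
Proof.
by apply/tensorsP => V b bb; rewrite !balanced_cat !balanced_sum_repr.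
Qed.

Fact base_change_oppE (s : seq (M * A)) :
  base_change_opp (tensors s) = tensors (tensors_opp s).
Proof.
by apply/tensorsP => V b bb; rewrite !balanced_opp ?balanced_sum_repr.
Qed.

Fact base_change_scaleE (a : A) (s : seq (M * A)) :
  base_change_scale a (tensors s) = tensors (tensors_scale a s).
Proof.
apply/tensorsP => V b bb; rewrite !balanced_scale balanced_sum_repr //.
exact: balanced_scale_map.
Qed.

Fact base_change_addA : associative base_change_add.
Proof.
elim/tensorsW=> s; elim/tensorsW=> t; elim/tensorsW=> u.
by rewrite !base_change_addE catA.
Qed.

Fact base_change_addC : commutative base_change_add.
Proof.
elim/tensorsW=> s; elim/tensorsW=> t; rewrite !base_change_addE.
by apply/tensorsP => V b bb; rewrite !balanced_cat addrC.
Qed.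

Fact base_change_add0 : left_id (tensors [::]) base_change_add.
Proof. by elim/tensorsW=> s; rewrite base_change_addE. Qed.

Fact base_change_addN :
  left_inverse (tensors [::]) base_change_opp base_change_add.
Proof.
elim/tensorsW=> s; rewrite base_change_oppE base_change_addE.
apply/tensorsP => V b bb.
by rewrite balanced_cat balanced_opp // addNr /balanced_sum big_nil.
Qed.

HB.instance Definition _ := GRing.isZmodule.Build base_change
  base_change_addA base_change_addC base_change_add0 base_change_addN.

Fact base_change_scalerA (a c : A) (z : base_change) :
  base_change_scale a (base_change_scale c z) = base_change_scale (a * c) z.
Proof.
elim/tensorsW: z => s; rewrite !base_change_scaleE /tensors_scale -map_comp.
by congr tensors; apply: eq_map => p /=; rewrite mulrA.
Qed.

Fact base_change_scale1r : left_id 1 base_change_scale.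
Proof.
elim/tensorsW=> s; rewrite base_change_scaleE; congr tensors.
by rewrite -[RHS]map_id; apply: eq_map => -[x a] /=; rewrite mul1r.
Qed.

Fact base_change_scalerDr : right_distributive base_change_scale +%R.
Proof.
move=> a; elim/tensorsW=> s; elim/tensorsW=> t.
rewrite [_ + _]base_change_addE !base_change_scaleE.
by rewrite [RHS]base_change_addE /tensors_scale map_cat.
Qed.

Fact base_change_scalerDl (z : base_change) :
  {morph base_change_scale^~ z : a c / a + c}.
Proof.
elim/tensorsW: z => s a c /=.
rewrite !base_change_scaleE [RHS]base_change_addE; apply/tensorsP => V b bb.
rewrite balanced_cat !balanced_scale /balanced_sum -big_split /=.
by case: bb => _ b2 _; apply: eq_bigr => p _; rewrite /scale_map mulrDl b2.
Qed.

HB.instance Definition _ := GRing.Zmodule_isLmodule.Build A base_change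
  base_change_scalerA base_change_scale1r base_change_scalerDr
  base_change_scalerDl.

End BaseChange.

Definition has_dimension (K : fieldType) (V : lmodType K) (n : nat) : Prop :=
  exists e : 'I_n -> V, forall v,
    exists! c : {ffun 'I_n -> K}, v = \sum_(i < n) c i *: e i.

(* The value 0 is a junk value when the dimension is infinite; this does not
   happen for a finitely generated M. *)
Definition rank (R : idomainType) (M : lmodType R) : nat :=
  xget 0%N [set n | has_dimension (base_change (@FracField.tofrac R) M) n].

Section Torsion.
Variables (R : idomainType) (M : lmodType R).

Definition torsion_pred (x : M) : bool :=
  `[< exists2 a : R, a != 0 & a *: x = 0 >].

Fact torsion_closed : subsemimod_closed torsion_pred.
Proof.
split; first split.
- by apply/asboolP; exists 1; rewrite ?oner_neq0 // scaler0.
- move=> x y /asboolP[a a0 ax] /asboolP[b b0 by0]; apply/asboolP.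
  exists (a * b); first exact: mulf_neq0.
  by rewrite scalerDr -[in X in _ + X]scalerA by0 mulrC -scalerA ax !scaler0 addr0.
move=> c x /asboolP[a a0 ax]; apply/asboolP; exists a => //.
by rewrite scalerA mulrC -scalerA ax scaler0.
Qed.

HB.instance Definition _ :=
  GRing.isSubmodClosed.Build R M torsion_pred torsion_closed.

Definition torsion_submodClosed := GRing.SubmodClosed.clone R M torsion_pred _.

Definition torsion : lmodType R := submodule torsion_submodClosed.
Definition mod_torsion : lmodType R := quotmodule torsion_submodClosed.

End Torsion.

Section Pic.
Variable R : idomainType.
Local Notation K := {fraction R}.

Definition is_fractional_ideal (I : set K) : Prop :=
  [/\ I 0, forall x y, I x -> I y -> I (x + y),
      forall (a : R) x, I x -> I (a%:F * x),
      exists2 x, I x & x != 0 &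
      exists2 d : R, d != 0 & forall x, I x -> exists a : R, d%:F * x = a%:F].

(* Nonzero fractional ideals of R. *)
Record fractional_ideal : Type := FractionalIdeal {
  fideal :> set K; fidealP : is_fractional_ideal fideal }.

HB.instance Definition _ := gen_eqMixin fractional_ideal.
HB.instance Definition _ := gen_choiceMixin fractional_ideal.

Fact fractional_ideal_inj (I J : fractional_ideal) :
  (I : set K) = J -> I = J.
Proof.
case: I J => I hI [J hJ] /= IJ; case: _ / IJ hJ => hJ.
by congr FractionalIdeal; exact: Prop_irrelevance.
Qed.

Definition fideal_equiv (I J : fractional_ideal) : bool :=
  `[< exists a b : R, [/\ a != 0, b != 0 &
        [set a%:F * x | x in (I : set K)] = [set b%:F * y | y in (J : set K)]] >].

Fact image_mulF (a c : R) (I : set K) :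
  [set c%:F * y | y in [set a%:F * x | x in I]] = [set (c * a)%:F * x | x in I].
Proof.
rewrite image_comp; apply: eq_imagel => x _ /=.
by rewrite tofracM mulrA.
Qed.

Fact fideal_equiv_is_equiv : equiv_class_of fideal_equiv.
Proof.
split=> [I|I J|J I L].
- by apply/asboolP; exists 1, 1; rewrite oner_neq0.
- by apply/asboolP/asboolP=> -[a [b [a0 b0 h]]]; exists b, a.
move=> /asboolP[a [b [a0 b0 hab]]] /asboolP[c [d [c0 d0 hcd]]].
apply/asboolP; exists (c * a), (b * d); split; try exact: mulf_neq0.
by rewrite -image_mulF hab image_mulF mulrC -(image_mulF c) hcd image_mulF.
Qed.

Canonical fideal_equiv_equiv := EquivRelPack fideal_equiv_is_equiv.
Canonical fideal_equiv_encModRel := defaultEncModRel fideal_equiv.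

(* Every class is invertible when R is a Dedekind domain; over an arbitrary
   domain the classes only form a monoid, which is enough to take powers. *)
Definition Pic : Type := {eq_quot fideal_equiv}.
HB.instance Definition _ : EqQuotient _ fideal_equiv Pic := EqQuotient.on Pic.
HB.instance Definition _ := Choice.on Pic.

Definition fideal_class (I : fractional_ideal) : Pic := \pi_Pic I.

Definition fideal_prod (I J : set K) : set K :=
  [set z | exists2 s : seq (K * K),
     (forall p, p \in s -> I p.1 /\ J p.2) & z = \sum_(p <- s) p.1 * p.2].

Definition sum_closed (L : set K) := L 0 /\ forall x y, L x -> L y -> L (x + y).

Fact fideal_prod_closed (I J : set K) : sum_closed (fideal_prod I J).
Proof.
split=> [|x y [s sP ->] [t tP ->]]; first by exists [::]; rewrite ?big_nil.
exists (s ++ t); last by rewrite big_cat.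
by move=> p; rewrite mem_cat => /orP[/sP|/tP].
Qed.

Fact fideal_prod_mem (I J : set K) x y : I x -> J y -> fideal_prod I J (x * y).
Proof.
move=> Ix Jy; exists [:: (x, y)]; last by rewrite big_seq1.
by move=> p; rewrite inE => /eqP ->.
Qed.

Fact fideal_prod_sub (I J L : set K) : sum_closed L ->
  (forall x y, I x -> J y -> L (x * y)) -> fideal_prod I J `<=` L.
Proof.
move=> [L0 LD] h z [s sP ->]; elim: s sP => [|p s IH] sP; first by rewrite big_nil.
rewrite big_cons; apply: LD.
  by have [] := sP p (mem_head _ _); exact: h.
by apply: IH => q qs; apply: sP; rewrite inE qs orbT.
Qed.

Fact fideal_prodP (I J : fractional_ideal) :
  is_fractional_ideal (fideal_prod I J).
Proof.
case: (fidealP I) => I0 ID IM [x Ix x0] [d d0 dP].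
case: (fidealP J) => J0 JD JM [y Jy y0] [e e0 eP].
have [P0 PD] := fideal_prod_closed I J.
split=> //.
- move=> a; apply: fideal_prod_sub => [|u v Iu Jv].
    split=> [|u v]; first by rewrite /= mulr0.
    by rewrite mulrDr; exact: PD.
  by rewrite mulrA; apply: fideal_prod_mem => //; exact: IM.
- by exists (x * y); [exact: fideal_prod_mem | exact: mulf_neq0].
exists (d * e); first exact: mulf_neq0.
apply: fideal_prod_sub => [|u v /dP[a ua] /eP[b vb]].
  split=> [|u v [a ua] [b vb]]; first by exists 0; rewrite mulr0 tofrac0.
  by exists (a + b); rewrite mulrDr ua vb tofracD.
by exists (a * b); rewrite !tofracM mulrACA ua vb.
Qed.

Definition fideal_mul (I J : fractional_ideal) : fractional_ideal :=
  FractionalIdeal (fideal_prodP I J).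

Fact fideal_oneP : is_fractional_ideal (range (@FracField.tofrac R)).
Proof.
split.
- by exists 0; rewrite ?tofrac0.
- by move=> x y [a _ <-] [b _ <-]; exists (a + b); rewrite ?tofracD.
- by move=> a x [b _ <-]; exists (a * b); rewrite ?tofracM.
- by exists 1; [exists 1; rewrite ?tofrac1 | exact: oner_neq0].
by exists 1; [exact: oner_neq0 | move=> x [a _ <-]; exists a; rewrite mul1r].
Qed.

Definition fideal_one : fractional_ideal := FractionalIdeal fideal_oneP.

Fact fideal_mulA : associative fideal_mul.
Proof.
move=> I J L; apply/fractional_ideal_inj/seteqP; split.
  apply: fideal_prod_sub; first exact: fideal_prod_closed.
  move=> x w Ix; move: w; apply: fideal_prod_sub => [|y z Jy Lz].
    have [P0 PD] := fideal_prod_closed (fideal_mul I J) L.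
    split=> [|u v]; first by rewrite /= mulr0.
    by rewrite mulrDr; exact: PD.
  by rewrite mulrA; do 2!apply: fideal_prod_mem => //.
apply: fideal_prod_sub; first exact: fideal_prod_closed.
move=> w z + Lz; move: w; apply: fideal_prod_sub => [|x y Ix Jy].
  have [P0 PD] := fideal_prod_closed I (fideal_mul J L).
  split=> [|u v]; first by rewrite /= mul0r.
  by rewrite mulrDl; exact: PD.
by rewrite -mulrA; do 2!apply: fideal_prod_mem => //.
Qed.

Fact fideal_mulC : commutative fideal_mul.
Proof.
suff h I J : fideal_mul I J `<=` fideal_mul J I.
  by move=> I J; apply/fractional_ideal_inj/seteqP; split; exact: h.
apply: fideal_prod_sub => [|x y Ix Jy]; first exact: fideal_prod_closed.
by rewrite mulrC; exact: fideal_prod_mem.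
Qed.

Fact fideal_mul1 : left_id fideal_one fideal_mul.
Proof.
move=> I; case: (fidealP I) => I0 ID IM _ _.
apply/fractional_ideal_inj/seteqP; split.
  by apply: fideal_prod_sub => // _ x [a _ <-]; exact: IM.
move=> x Ix; rewrite -[x]mul1r; apply: fideal_prod_mem => //.
by exists 1; rewrite ?tofrac1.
Qed.

Fact fideal_prod_image (a c : R) (I J : set K) :
  fideal_prod [set a%:F * x | x in I] [set c%:F * x | x in J] =
  [set (a * c)%:F * x | x in fideal_prod I J].
Proof.
apply/seteqP; split.
  apply: fideal_prod_sub => [|_ _ [x Ix <-] [y Jy <-]].
    have [P0 PD] := fideal_prod_closed I J.
    split=> [|_ _ [u hu <-] [v hv <-]]; first by exists 0; rewrite ?mulr0.
    by exists (u + v); [exact: PD | rewrite mulrDr].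
  exists (x * y); first exact: fideal_prod_mem.
  by rewrite tofracM mulrACA.
move=> _ [z hz <-]; move: z hz; apply: fideal_prod_sub => [|x y Ix Jy].
  have [P0 PD] := fideal_prod_closed [set a%:F * x | x in I] [set c%:F * x | x in J].
  split=> [|u v]; first by rewrite /= mulr0.
  by rewrite mulrDr; exact: PD.
rewrite tofracM mulrACA.
by apply: fideal_prod_mem; [exists x | exists y].
Qed.

Fact fideal_mul_compat (I I' J J' : fractional_ideal) :
  fideal_class I = fideal_class I' -> fideal_class J = fideal_class J' ->
  fideal_class (fideal_mul I J) = fideal_class (fideal_mul I' J').
Proof.
move=> /eqmodP/asboolP[a [b [a0 b0 hab]]] /eqmodP/asboolP[c [d [c0 d0 hcd]]].
apply/eqmodP/asboolP; exists (a * c), (b * d); split; try exact: mulf_neq0.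
by rewrite -!fideal_prod_image hab hcd.
Qed.

Definition Pic_mul (x y : Pic) : Pic :=
  fideal_class (fideal_mul (repr x) (repr y)).

Fact Pic_mulE (I J : fractional_ideal) :
  Pic_mul (fideal_class I) (fideal_class J) = fideal_class (fideal_mul I J).
Proof. by apply: fideal_mul_compat; rewrite /fideal_class reprK. Qed.

Fact Pic_mulA : associative Pic_mul.
Proof.
elim/quotW=> I; elim/quotW=> J; elim/quotW=> L.
by rewrite -!/(fideal_class _) !Pic_mulE fideal_mulA.
Qed.

Fact Pic_mulC : commutative Pic_mul.
Proof. by elim/quotW=> I; elim/quotW=> J; rewrite !Pic_mulE fideal_mulC. Qed.

Fact Pic_mul1 : left_id (fideal_class fideal_one) Pic_mul.
Proof. by elim/quotW=> I; rewrite Pic_mulE fideal_mul1. Qed.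

Fact Pic_mulr1 : right_id (fideal_class fideal_one) Pic_mul.
Proof. by move=> x; rewrite Pic_mulC Pic_mul1. Qed.

HB.instance Definition _ := isMonoid.Build Pic Pic_mulA Pic_mul1 Pic_mulr1.

Section IdealClass.
Variables (I : submodClosed R^o) (I_neq0 : exists2 a : R, a \in I & a != 0).

Fact ideal_fractional : is_fractional_ideal [set a%:F | a in [set a : R | a \in I]].
Proof.
split.
- by exists 0; rewrite ?tofrac0 //; exact: (@rpred0 _ I).
- move=> x y [a Ia <-] [b Ib <-]; exists (a + b); rewrite ?tofracD //.
  exact: (@rpredD _ I).
- move=> a x [b Ib <-]; exists (a * b); rewrite ?tofracM //.
  exact: (@rpredZ _ _ I).
- case: I_neq0 => a Ia a0; exists a%:F; first by exists a.
  by rewrite tofrac_eq0.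
by exists 1; [exact: oner_neq0 | move=> x [a _ <-]; exists a; rewrite mul1r].
Qed.

Definition ideal_class : Pic := fideal_class (FractionalIdeal ideal_fractional).

End IdealClass.

(* The value 1 is a junk value, taken in particular when M is torsion. *)
Definition steinitz_class (M : lmodType R) : Pic :=
  xget (1%g : Pic) [set c | exists (I : submodClosed R^o)
    (I_neq0 : exists2 a : R, a \in I & a != 0),
    isomorphic (mod_torsion M) ({ffun 'I_(rank M).-1 -> R^o} * submodule I)%type /\
    c = ideal_class I_neq0].

End Pic.

(* Main.v *)
(* The inequality spl(M, N) >= t means that N^t is a direct summand of M.  Over
   a Dedekind domain M is Tor(M) + R^(n-1) + I, so one compares the torsion parts
   and the torsion-free parts separately.

   Torsion-free parts: by Steinitz' isomorphism I + J = R + IJ, the module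
   R^(n-1) + I is determined by n and [I]; both are invariants, the class because
   the determinant of an isomorphism R^n + I -> R^n + J carries I onto J.

   Torsion parts: clearing denominators, a local splitting at m yields maps
   f : M -> N^t and g : N^t -> M with f g = s for some s outside m.  Let a be the
   annihilator of Tor(N); its overlying maximal ideals are associated primes of N.
   As R/a is Artinian, a multiple of s is an idempotent mod a outside m, and
   splittings over two idempotents e, e' combine into one over e + (1 - e) e';
   these idempotents are in no common maximal ideal, so 1 is reached.  Neither
   unique factorization of ideals nor the structure of torsion modules is used. *)
Require Import Defs.
From HB Require Import structures.
From mathcomp Require Import all_boot all_order all_algebra.
From mathcomp Require Import ring_quotient generic_quotient fraction.
From mathcomp Require Import boolp classical_sets functions constructive_ereal.
From mathcomp Require Import ring.
Set Implicit Arguments.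
Unset Strict Implicit.
Unset Printing Implicit Defensive.
Import Order.TTheory GRing.Theory Num.Theory.
Local Open Scope ring_scope.
Local Open Scope quotient_scope.
Local Open Scope classical_set_scope.

(** * Linear maps, submodules and quotients *)

(** Projectivity of ideals is used through dual bases. For [d != 0] in an ideal [I], the dual
    functionals are multiplications by fractions [c_i / d], so [d = sum c_i g_i] with [g_i] in [I]:
    this is [I I^{-1} = R] with denominators cleared, and [colon d I] stands for [d I^{-1}] inside
    [R].

    The gluing of idempotents serves twice: for splittings of torsion modules, and for replacing an
    ideal by an isomorphic one coprime to another, the step of Steinitz' isomorphism that is usually
    derived from prime factorization.

    A map between localizations comes from a map of modules, up to a denominator, because the
    relations between finitely many generators are finitely generated; they form a submodule of some
    [R^k], and such submodules decompose into ideals. The lifted maps live on [M] and [N] and are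
    restricted to torsion afterwards, so that the torsion of a localization never has to be
    computed.

    The zero module is a separate case on the torsion-free side, since the form [R^n + I] with [I]
    nonzero starts at rank 1. *)

Section LinearMaps.
Variable R : pzRingType.
Implicit Types U V W P Q : lmodType R.

Definition mk_linear U V (f : U -> V) (hf : linear f) : {linear U -> V} :=
  HB.pack f (@GRing.isLinear.Build R U V *:%R f hf).

Lemma lin_scale U V (f : {linear U -> V}) a x : f (a *: x) = a *: f x.
Proof. exact: linearZ. Qed.

Fact to_submodule_linear U V (S : submodClosed V) (f : {linear U -> V})
    (fS : forall x, f x \in S) : linear (fun x => Submodule (fS x)).
Proof. by move=> a x y; apply: val_inj; exact: linearP. Qed.

Definition to_submodule U V (S : submodClosed V) (f : {linear U -> V})
    (fS : forall x, f x \in S) : {linear U -> submodule S} :=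
  mk_linear (to_submodule_linear fS).

Fact from_submodule_linear V (S : submodClosed V) :
  linear (fun x : submodule S => val x : V).
Proof. by []. Qed.

Definition from_submodule V (S : submodClosed V) : {linear submodule S -> V} :=
  mk_linear (@from_submodule_linear V S).

Section Predicate.
Variables (V : lmodType R) (p : V -> Prop).
Hypothesis (p0 : p 0) (pD : forall x y, p x -> p y -> p (x + y)).
Hypothesis pZ : forall a x, p x -> p (a *: x).

Definition prop_pred (x : V) : bool := `[< p x >].

Fact prop_pred_closed : subsemimod_closed prop_pred.
Proof.
split; first split; first exact/asboolP.
  by move=> x y /asboolP px /asboolP py; apply/asboolP/pD.
by move=> a x /asboolP px; apply/asboolP/pZ.
Qed.

Definition prop_submod : submodClosed V :=
  HB.pack prop_pred (GRing.isSubmodClosed.Build R V prop_pred prop_pred_closed).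

Lemma mem_prop_submod x : (x \in prop_submod) = `[< p x >].
Proof. by []. Qed.
End Predicate.

Lemma isomorphicP U V : isomorphic U V <->
  exists (f : {linear U -> V}) (g : {linear V -> U}), cancel f g /\ cancel g f.
Proof.
split=> [[f [g fK gK]]|[f [g [fK gK]]]]; last by exists f, g.
have gL : linear g.
  by move=> a x y; apply: (can_inj fK); rewrite linearP !gK.
by exists f, (mk_linear gL).
Qed.

Lemma iso_refl U : isomorphic U U.
Proof. by exists (GRing.Linear.clone _ _ _ _ (@idfun U) _), id. Qed.

Lemma iso_sym U V : isomorphic U V -> isomorphic V U.
Proof. by move=> /isomorphicP[f [g [fK gK]]]; exists g, f. Qed.

Lemma iso_trans U V W : isomorphic U V -> isomorphic V W -> isomorphic U W.
Proof.
move=> [f fb] [g gb]; exists (GRing.Linear.clone _ _ _ _ (g \o f) _).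
exact: bij_comp.
Qed.

Lemma iso_prod U U' V V' : isomorphic U U' -> isomorphic V V' ->
  isomorphic (U * V)%type (U' * V')%type.
Proof.
move=> [f [f' fK f'K]] [g [g' gK g'K]].
have L : linear (fun x : U * V => (f x.1, g x.2)).
  by move=> a x y; rewrite /= !linearP.
exists (mk_linear L), (fun x => (f' x.1, g' x.2)) => -[x y] /=.
  by rewrite fK gK.
by rewrite f'K g'K.
Qed.

Lemma iso_prodC U V : isomorphic (U * V)%type (V * U)%type.
Proof.
have L : linear (fun x : U * V => (x.2, x.1)) by [].
by exists (mk_linear L), (fun x => (x.2, x.1)) => -[].
Qed.

Lemma iso_prodA U V W : isomorphic (U * (V * W))%type ((U * V) * W)%type.
Proof.
have L : linear (fun x : U * (V * W) => ((x.1, x.2.1), x.2.2)) by [].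
by exists (mk_linear L), (fun x => (x.1.1, (x.1.2, x.2))) => [[x []]|[[]]].
Qed.

Lemma iso_prodACA U V U' V' :
  isomorphic ((U * V) * (U' * V'))%type ((U * U') * (V * V'))%type.
Proof.
have L : linear (fun x : (U * V) * (U' * V') => ((x.1.1, x.2.1), (x.1.2, x.2.2))).
  by [].
exists (mk_linear L), (fun x => ((x.1.1, x.2.1), (x.1.2, x.2.2))).
  by move=> [[? ?] [? ?]].
by move=> [[? ?] [? ?]].
Qed.

Lemma iso_prod0l U V : (forall x : U, x = 0) -> isomorphic (U * V)%type V.
Proof.
move=> U0; have L : linear (fun x : U * V => x.2) by [].
by exists (mk_linear L), (fun y => (0, y)) => // -[x y] /=; rewrite (U0 x).
Qed.

Lemma iso_prod0r U V : (forall x : V, x = 0) -> isomorphic (U * V)%type U.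
Proof. by move=> V0; exact: iso_trans (iso_prodC _ _) (iso_prod0l _ V0). Qed.

Lemma ffun_ord0 V (x : {ffun 'I_0 -> V}) : x = 0.
Proof. by apply/ffunP => -[]. Qed.

Lemma iso_ffunS V n :
  isomorphic {ffun 'I_n.+1 -> V} (V * {ffun 'I_n -> V})%type.
Proof.
pose f (x : {ffun 'I_n.+1 -> V}) : V * {ffun 'I_n -> V} :=
  (x ord0, [ffun i => x (lift ord0 i)]).
pose g (x : V * {ffun 'I_n -> V}) : {ffun 'I_n.+1 -> V} :=
  [ffun i => oapp x.2 x.1 (unlift ord0 i)].
have L : linear f.
  move=> a x y; rewrite /f !ffunE; congr pair.
  by apply/ffunP => i; rewrite !ffunE.
exists (mk_linear L), g => [x|[x y]] /=.
  by apply/ffunP => i; rewrite !ffunE; case: unliftP => [j ->|->] /=; rewrite ?ffunE.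
rewrite /f /g ffunE unlift_none; congr pair.
by apply/ffunP => i; rewrite !ffunE liftK.
Qed.

Lemma iso_ffun1 V : isomorphic {ffun 'I_1 -> V} V.
Proof. by apply: iso_trans (iso_ffunS _ _) (iso_prod0r _ _); exact: ffun_ord0. Qed.

Lemma iso_ffunD V m n :
  isomorphic {ffun 'I_(m + n) -> V} ({ffun 'I_m -> V} * {ffun 'I_n -> V})%type.
Proof.
elim: m => [|m IH]; first exact/iso_sym/iso_prod0l/ffun_ord0.
apply: iso_trans (iso_ffunS _ _) _.
apply: iso_trans (iso_prod (iso_refl _) IH) _.
apply: iso_trans (iso_prodA _ _ _) _.
exact: iso_prod (iso_sym (iso_ffunS _ _)) (iso_refl _).
Qed.

Lemma projective_iso P Q : isomorphic P Q -> projective P -> projective Q.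
Proof.
move=> /isomorphicP[f [f' [fK f'K]]] pP U V p g ps.
have [h hE] := pP _ _ p (GRing.Linear.clone _ _ _ _ (g \o f) _) ps.
exists (GRing.Linear.clone _ _ _ _ (h \o f') _) => x /=.
by rewrite hE /= f'K.
Qed.

Lemma projective_prod P Q : projective P -> projective Q ->
  projective (P * Q)%type.
Proof.
move=> pP pQ U V p g ps.
have L1 : linear (fun x => g (x, 0) : V).
  move=> a x y; rewrite -linearP; congr (g _).
  by congr pair; rewrite /= scaler0 addr0.
have L2 : linear (fun x => g (0, x) : V).
  move=> a x y; rewrite -linearP; congr (g _).
  by congr pair; rewrite /= scaler0 addr0.
have [h1 h1E] := pP _ _ p (mk_linear L1) ps.
have [h2 h2E] := pQ _ _ p (mk_linear L2) ps.
have L : linear (fun x : P * Q => h1 x.1 + h2 x.2).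
  by move=> a x y; rewrite /= !linearP scalerDr addrACA.
exists (mk_linear L) => -[x y] /=.
rewrite linearD h1E h2E /= -linearD; congr (g _).
by congr pair; rewrite /= ?addr0 ?add0r.
Qed.

Lemma projective_zero P : (forall x : P, x = 0) -> projective P.
Proof.
move=> P0 U V p g ps; exists \0 => x.
by rewrite linear0 (P0 x) linear0.
Qed.

Lemma projective_regular : projective R^o.
Proof.
move=> U V p g ps; have [u uE] := ps (g 1).
have L : linear (fun a : R^o => a *: u).
  by move=> a x y; rewrite scalerDl scalerA.
exists (mk_linear L) => x /=.
by rewrite linearZ uE -linearZ /= /GRing.scale /= mulr1.
Qed.

Lemma projective_ffun n P : projective P -> projective {ffun 'I_n -> P}.
Proof.
move=> pP; elim: n => [|n IH]; first exact/projective_zero/ffun_ord0.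
exact: projective_iso (iso_sym (iso_ffunS _ _)) (projective_prod pP IH).
Qed.

Section Kernel.
Variables (V W : lmodType R) (f : {linear V -> W}).
Fact ker_closed0 : f 0 = 0. Proof. exact: linear0. Qed.
Fact ker_closedD x y : f x = 0 -> f y = 0 -> f (x + y) = 0.
Proof. by move=> fx fy; rewrite linearD fx fy addr0. Qed.
Fact ker_closedZ a x : f x = 0 -> f (a *: x) = 0.
Proof. by move=> fx; rewrite linearZ /= fx scaler0. Qed.
Definition kernel := prop_submod ker_closed0 ker_closedD ker_closedZ.
Lemma mem_kernel x : (x \in kernel) = (f x == 0).
Proof. by rewrite mem_prop_submod; exact/asboolP/eqP. Qed.

Definition range_prop y := exists x, f x = y.
Fact range_closed0 : range_prop 0. Proof. by exists 0; rewrite linear0. Qed.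
Fact range_closedD x y : range_prop x -> range_prop y -> range_prop (x + y).
Proof. by move=> [u <-] [v <-]; exists (u + v); rewrite linearD. Qed.
Fact range_closedZ a x : range_prop x -> range_prop (a *: x).
Proof. by move=> [u <-]; exists (a *: u); rewrite linearZ. Qed.
Definition lin_range := prop_submod range_closed0 range_closedD range_closedZ.
Lemma mem_lin_range x : f x \in lin_range.
Proof. by rewrite mem_prop_submod; apply/asboolP; exists x. Qed.
Lemma lin_rangeP y : y \in lin_range -> exists x, f x = y.
Proof. by rewrite mem_prop_submod => /asboolP. Qed.

Lemma split_kernel (g : {linear W -> V}) : cancel g f ->
  isomorphic V (submodule kernel * W)%type.
Proof.
move=> gK.
have L0 : linear (fun x => x - g (f x)).
  by move=> a x y; rewrite (linearP f) (linearP g) scalerBr opprD addrACA.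
have kf x : mk_linear L0 x \in kernel.
  by rewrite mem_kernel /= linearB gK subrr.
have L : linear (fun x => (to_submodule kf x, f x)).
  by move=> a x y; rewrite !linearP.
exists (mk_linear L), (fun y => val y.1 + g y.2) => [x|[[x kx] y]] /=.
  by rewrite subrK.
have fx : f x = 0 by apply/eqP; rewrite -mem_kernel.
have fE : f (x + g y) = y by rewrite linearD fx gK add0r.
congr pair => //; apply: val_inj; rewrite /= fE; exact: addrK.
Qed.

Lemma projective_kernel : projective W -> (forall y, exists x, f x = y) ->
  isomorphic V (submodule kernel * W)%type.
Proof.
move=> pW fs; have [g gE] := pW _ _ f (GRing.Linear.clone _ _ _ _ idfun _) fs.
exact: split_kernel gE.
Qed.

(** [S] is only required to have the members of the kernel: quotients by two predicates with the
    same members are different types, and the quotient in use is the one by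
    [torsion_submodClosed]. *)
Lemma first_iso : (forall y, exists x, f x = y) ->
  forall S : submodClosed V, (forall x, (x \in S) = (f x == 0)) ->
  isomorphic (quotmodule S) W.
Proof.
move=> fs S SE.
pose q (x : quotmodule S) : W := f (repr (x : Quotient.quot (submodule_zmodClosed S))).
have qE x : q (\pi_(Quotient.quot (submodule_zmodClosed S)) x) = f x.
  apply/eqP; rewrite /q -subr_eq0 -linearB -SE.
  have : repr (\pi_(Quotient.quot (submodule_zmodClosed S)) x) - x
    \in submodule_zmodClosed S by rewrite Quotient.idealrBE reprK.
  by [].
have L : linear q.
  move=> a; elim/(@quotW _ (Quotient.quot (submodule_zmodClosed S)))=> x.
  elim/(@quotW _ (Quotient.quot (submodule_zmodClosed S)))=> y.
  rewrite [_ *: _]quotmodule_scale_pi -quotmodule_pi_add !qE.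
  exact: linearP.
have qs y : exists x, mk_linear L x = y.
  have [x <-] := fs y.
  by exists (\pi_(Quotient.quot (submodule_zmodClosed S)) x); exact: qE.
have qi : injective (mk_linear L).
  elim/(@quotW _ (Quotient.quot (submodule_zmodClosed S)))=> x.
  elim/(@quotW _ (Quotient.quot (submodule_zmodClosed S)))=> y /=.
  rewrite !qE => fxy; apply/eqP; rewrite -Quotient.idealrBE.
  suff : x - y \in S by [].
  by rewrite SE linearB fxy subrr.
exists (mk_linear L), (fun y => sval (cid (qs y))) => [x|y].
  by apply: qi; case: cid.
by case: cid.
Qed.

End Kernel.

Definition quot_proj V (S : submodClosed V) : {linear V -> quotmodule S} :=
  @mk_linear V (quotmodule S) (\pi_(Quotient.quot (submodule_zmodClosed S)))
   (fun a x y => etrans (quotmodule_pi_add _ (a *: x) y)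
     (congr1 (+%R^~ _) (esym (quotmodule_scale_pi _ a x)))).

Lemma quot_proj_eq0 V (S : submodClosed V) x : (quot_proj S x == 0) = (x \in S).
Proof.
rewrite -[x in RHS]subr0.
have -> : (x - 0 \in S) = (x - 0 \in submodule_zmodClosed S) by [].
rewrite Quotient.idealrBE; congr (_ == _).
exact/esym/(linear0 (quot_proj S)).
Qed.

Lemma quot_proj_surj V (S : submodClosed V) y : exists x, quot_proj S x = y.
Proof.
by elim/(@quotW _ (Quotient.quot (submodule_zmodClosed S))): y => x; exists x.
Qed.

Lemma fg_surj V W (f : {linear V -> W}) : (forall y, exists x, f x = y) ->
  finitely_generated V -> finitely_generated W.
Proof.
move=> fs [n [g gP]]; exists n, (f \o g) => y.
have [x <-] := fs y; have [c ->] := gP x; exists c.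
by rewrite linear_sum; apply: eq_bigr => i _; rewrite linearZ.
Qed.

Lemma fg_iso V W : isomorphic V W -> finitely_generated V -> finitely_generated W.
Proof.
move=> [f [g fK gK]]; apply: (@fg_surj _ _ f) => y.
by exists (g y); rewrite gK.
Qed.

Lemma quot_map V W (S : submodClosed V) (S' : submodClosed W) (f : {linear V -> W}) :
  (forall x, x \in S -> f x \in S') ->
  exists F : {linear quotmodule S -> quotmodule S'},
    forall x, F (quot_proj S x) = quot_proj S' (f x).
Proof.
move=> fS; have [h hE] := choice (quot_proj_surj (S := S)).
pose F y := quot_proj S' (f (h y)).
have FE x : F (quot_proj S x) = quot_proj S' (f x).
  apply/eqP; rewrite -subr_eq0 -linearB -linearB quot_proj_eq0; apply: fS.
  by rewrite -quot_proj_eq0 linearB hE subrr.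
have L : linear F.
  move=> a y z; rewrite -[y]hE -[z]hE.
  by rewrite -linearP !FE !linearP.
by exists (mk_linear L).
Qed.

Lemma fg_prod V W : finitely_generated V -> finitely_generated W ->
  finitely_generated (V * W)%type.
Proof.
move=> [m [g gP]] [n [h hP]].
exists (m + n)%N, (fun i =>
  match fintype.split i with inl j => (g j, 0) : V * W | inr j => (0, h j) end).
move=> [x y]; have [c cE] := gP x; have [d dE] := hP y.
exists (fun i => match fintype.split i with inl j => c j | inr j => d j end).
rewrite big_split_ord /=.
under eq_bigr do rewrite (unsplitK (inl _)).
under [X in _ = _ + X]eq_bigr do rewrite (unsplitK (inr _)).
have L1 : linear (fun x : V => (x, 0) : V * W).
  by move=> a u v; congr pair; rewrite /= scaler0 addr0.
have L2 : linear (fun x : W => (0, x) : V * W).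
  by move=> a u v; congr pair; rewrite /= scaler0 addr0.
have -> : (x, y) = mk_linear L1 x + mk_linear L2 y.
  by congr pair; rewrite /= ?addr0 ?add0r.
by rewrite {1}cE {1}dE !linear_sum; congr (_ + _); apply: eq_bigr => i _;
  rewrite lin_scale.
Qed.

Lemma fg_zero V : (forall x : V, x = 0) -> finitely_generated V.
Proof.
by move=> V0; exists 0%N, (fun=> 0) => x; exists (fun=> 0); rewrite [LHS]V0 big_ord0.
Qed.

Lemma fg_regular : finitely_generated R^o.
Proof.
exists 1%N, (fun=> 1) => x; exists (fun=> x); rewrite big_ord1.
exact: esym (mulr1 x).
Qed.

Lemma fg_ffun V n : finitely_generated V -> finitely_generated {ffun 'I_n -> V}.
Proof.
move=> fgV; elim: n => [|n IH]; first exact/fg_zero/ffun_ord0.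
exact: fg_iso (iso_sym (iso_ffunS _ _)) (fg_prod fgV IH).
Qed.

(** Coefficients of each vector are chosen arbitrarily; since relations among the [g i] hold among
    the [h i], the image does not depend on the choice, and linearity follows. *)
Lemma linear_of_generators V W k (g : 'I_k -> V) (h : 'I_k -> W) :
  (forall v, exists c : 'I_k -> R, v = \sum_i c i *: g i) ->
  (forall c : 'I_k -> R, \sum_i c i *: g i = 0 -> \sum_i c i *: h i = 0) ->
  exists f : {linear V -> W}, forall i, f (g i) = h i.
Proof.
move=> /choice[c cE] gh.
have ghE (a b : 'I_k -> R) : \sum_i a i *: g i = \sum_i b i *: g i ->
    \sum_i a i *: h i = \sum_i b i *: h i.
  move=> /eqP; rewrite -subr_eq0 -sumrB => /eqP E; apply/eqP.
  rewrite -subr_eq0 -sumrB; apply/eqP.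
  under eq_bigr do rewrite -scalerBl.
  by apply: (gh (fun i => a i - b i)); under eq_bigr do rewrite scalerBl.
pose f v := \sum_i c v i *: h i.
have L : linear f.
  move=> a u v; rewrite /f scaler_sumr -big_split /=.
  under [RHS]eq_bigr do rewrite scalerA -scalerDl.
  apply: (ghE _ (fun i => a * c u i + c v i)); rewrite -cE.
  under eq_bigr do rewrite scalerDl -scalerA.
  by rewrite big_split /= -scaler_sumr -!cE.
exists (mk_linear L) => i /=.
have -> : h i = \sum_j (j == i)%:R *: h j.
  rewrite (bigD1 i) //= eqxx scale1r big1 ?addr0 // => j /negPf ->.
  by rewrite scale0r.
apply: ghE; rewrite -cE (bigD1 i) //= eqxx scale1r big1 ?addr0 // => j /negPf ->.
by rewrite scale0r.
Qed.

Lemma iso_submodule_eq V (S S' : submodClosed V) :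
  (forall x, (x \in S) = (x \in S')) -> isomorphic (submodule S) (submodule S').
Proof.
move=> SE.
have fS (x : submodule S) : @from_submodule _ S x \in S'.
  by rewrite -SE; exact: submodule_mem.
have gS (x : submodule S') : @from_submodule _ S' x \in S.
  by rewrite SE; exact: submodule_mem.
by exists (to_submodule fS), (to_submodule gS) => x; apply: val_inj.
Qed.

End LinearMaps.

Arguments from_submodule {R V} S.

(** * Split surjections onto powers *)

Section Splits.
Variable R : pzRingType.
Implicit Types P Q : lmodType R.

(** The matrix form of a split surjection onto the [t]-th power: localizing, restricting to torsion
    and weighting by ring elements act on it entry by entry. *)
Definition splits t P Q := exists (f : 'I_t -> {linear P -> Q})
  (g : 'I_t -> {linear Q -> P}), forall k l x, f k (g l x) = (k == l)%:R *: x.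

Lemma splitsP t P Q : splits t P Q <->
  exists f : {linear P -> {ffun 'I_t -> Q}}, split_surjection f.
Proof.
split=> [[f [g fg]]|[f [g gK]]].
  have Lf : linear (fun x => [ffun k => f k x]).
    by move=> a x y; apply/ffunP => k; rewrite !ffunE linearP.
  have Lg : linear (fun v : {ffun 'I_t -> Q} => \sum_l g l (v l)).
    move=> a u v; rewrite scaler_sumr -big_split; apply: eq_bigr => l _ /=.
    by rewrite !ffunE linearP.
  exists (mk_linear Lf), (mk_linear Lg) => v; apply/ffunP => k.
  rewrite ffunE /= linear_sum (bigD1 k) //= fg eqxx scale1r big1 ?addr0 // => l lk.
  by rewrite fg eq_sym (negPf lk) scale0r.
have Lf k : linear (fun x => f x k).
  by move=> a x y; rewrite linearP !ffunE.
have Lg l : linear (fun x => g [ffun i => (i == l)%:R *: x]).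
  move=> a x y; rewrite -linearP; congr (g _); apply/ffunP => i.
  by rewrite !ffunE; case: eqP => _; rewrite ?scale1r // !scale0r scaler0 addr0.
exists (fun k => mk_linear (Lf k)), (fun l => mk_linear (Lg l)) => k l x /=.
by rewrite gK ffunE.
Qed.

Lemma splits_le s t P Q : (s <= t)%N -> splits t P Q -> splits s P Q.
Proof.
move=> st [f [g fg]].
exists (f \o widen_ord st), (g \o widen_ord st) => k l x /=.
by rewrite fg.
Qed.

Lemma splP t P Q : (t%:Z%:E <= spl P Q)%E <-> splits t P Q.
Proof.
pose S := [set s : nat | splits s P Q].
have S0 : S 0%N by exists (fun=> \0), (fun=> \0) => -[].
set A := [set (s%:Z)%:E | s in S] : set (\bar int).
have -> : spl P Q = supremum 0%E A.
  congr supremum; apply/seteqP; split=> _ [s sP <-]; exists s => //;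
  by apply/splitsP.
have A0 : A !=set0 by exists 0%E, 0%N.
(* [supremum] selects from [supremums A] by choice with a default, so a least upper bound must be
   exhibited: the maximum of a bounded set, [+oo] otherwise. *)
have sA : supremums A !=set0.
  case: (pselect (exists n : nat, forall s, S s -> (s <= n)%N)) => [[n nub]|unb].
    have /ex_maxnP-/(_ n)[] : exists i, `[< S i >] by exists 0%N; exact/asboolP.
      by move=> i /asboolP; exact: nub.
    move=> m /asboolP Sm mub; exists m%:Z%:E; split.
      by move=> _ [s Ss <-]; rewrite lee_fin lez_nat; apply/mub/asboolP.
    by move=> y; apply; exists m.
  exists +oo%E; split=> [y _|y yub]; first exact: leey.
  case: y yub => [r| |] yub //; exfalso; last by have := yub 0%E (ex_intro2 _ _ 0%N S0 erefl).
  apply: unb; exists `|r|%N => s Ss.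
  have := yub _ (ex_intro2 _ _ s Ss erefl); rewrite lee_fin => sr.
  by rewrite -lez_nat; apply: le_trans sr _; rewrite lez_abs.
have [y yS] := sA.
have supE : supremum 0%E A = y.
  rewrite /supremum; case: ifPn => [/eqP A0'|_]; first by case: A0 => z; rewrite A0'.
  by case: xgetP => [z _ zS|/(_ y)//]; exact: (is_subset1_supremums zS yS).
rewrite supE; split=> [ty|sP]; last by apply: yS.1; exists t.
(* The set of exponents is closed downwards, so if it misses [t] it is bounded by [t - 1]. *)
case: (pselect (splits t P Q)) => // nsP.
have bnd s : S s -> (s < t)%N.
  by move=> Ss; rewrite ltnNge; apply/negP => /splits_le/(_ Ss).
have t0 : (0 < t)%N by exact: leq_ltn_trans (bnd _ S0).
have : (y <= t.-1%:Z%:E)%E.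
  apply: yS.2 => _ [s Ss <-]; rewrite lee_fin lez_nat.
  by rewrite -ltnS prednK //; exact: bnd.
move=> /(le_trans ty); rewrite lee_fin lez_nat.
by rewrite -ltnS prednK // ltnn.
Qed.

Lemma spl_eq t P Q : splits t P Q -> ~ splits t.+1 P Q -> spl P Q = t%:Z%:E.
Proof.
move=> /splP tP /splP/negP; rewrite -ltNge => tlt; apply/eqP.
by rewrite eq_le tP andbT; case: (spl P Q) tP tlt.
Qed.

Lemma splits_iso t P P' Q Q' : isomorphic P P' -> isomorphic Q Q' ->
  splits t P Q -> splits t P' Q'.
Proof.
move=> /isomorphicP[p [p' [pK p'K]]] /isomorphicP[q [q' [qK q'K]]] [f [g fg]].
exists (fun k => GRing.Linear.clone _ _ _ _ (q \o f k \o p') _).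
exists (fun l => GRing.Linear.clone _ _ _ _ (p \o g l \o q') _) => k l x /=.
by rewrite pK fg linearZ /= q'K.
Qed.

Lemma splits_prod t P P' Q Q' : splits t P Q -> splits t P' Q' ->
  splits t (P * P')%type (Q * Q')%type.
Proof.
move=> [f [g fg]] [f' [g' fg']].
have Lf k : linear (fun x : P * P' => (f k x.1, f' k x.2)).
  by move=> a x y /=; rewrite !linearP.
have Lg k : linear (fun x : Q * Q' => (g k x.1, g' k x.2)).
  by move=> a x y /=; rewrite !linearP.
exists (fun k => mk_linear (Lf k)), (fun l => mk_linear (Lg l)) => k l x /=.
by rewrite fg fg'.
Qed.

(** The embedding of [C] in [P] is recorded because it places [C] inside a free module whenever [P]
    embeds in one. *)
Lemma splits_complement t P Q : splits t P Q ->
  exists (C : lmodType R) (f : {linear C -> P}), injective f /\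
    isomorphic P ({ffun 'I_t -> Q} * C)%type.
Proof.
move=> /splitsP[f [g gK]].
exists (submodule (kernel f)), (from_submodule (kernel f)); split.
  exact: val_inj.
exact: iso_trans (split_kernel gK) (iso_prodC _ _).
Qed.

Lemma complement_splits t P Q (C : lmodType R) :
  isomorphic P ({ffun 'I_t -> Q} * C)%type -> splits t P Q.
Proof.
move=> /isomorphicP[f [g [fK gK]]]; apply/splitsP.
have Lf : linear (fun x => (f x).1) by move=> a x y; rewrite linearP.
have Lg : linear (fun x => g (x, 0)).
  move=> a x y; rewrite -linearP; congr (g _).
  by congr pair; rewrite /= scaler0 addr0.
by exists (mk_linear Lf), (mk_linear Lg) => x /=; rewrite gK.
Qed.

Lemma splits0 t P Q : (forall x : Q, x = 0) -> splits t P Q.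
Proof.
move=> Q0; exists (fun=> \0), (fun=> \0) => k l x.
by rewrite [LHS]Q0 (Q0 x) scaler0.
Qed.

End Splits.

(** * Dual bases and ideals *)

Section DualBasis.
Variables (R : pzRingType) (P : lmodType R).

Definition finite_support (f : P -> R^o) := exists s : seq P,
  forall x, x \notin s -> f x = 0.

Fact finite_support0 : finite_support 0.
Proof. by exists [::]. Qed.

Fact finite_supportD f g :
  finite_support f -> finite_support g -> finite_support (f + g).
Proof.
move=> [s fs] [t gt]; exists (s ++ t) => x; rewrite mem_cat negb_or => /andP[xs xt].
by rewrite fctE fs // gt // addr0.
Qed.

Fact finite_supportZ a f : finite_support f -> finite_support (a *: f).
Proof.
move=> [s fs]; exists s => x xs.
by rewrite -[LHS]/(a *: (f x)) fs // scaler0.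
Qed.

(** The free module on the underlying set of [P]; the coordinates of a section of [total], its
    canonical map onto [P], form the dual basis. *)
Definition free_module : lmodType R :=
  submodule (prop_submod finite_support0 finite_supportD finite_supportZ).

Definition coef (f : free_module) (x : P) : R := val f x.

Lemma finite_supportP (f : free_module) : exists s : seq P,
  uniq s /\ forall x, x \notin s -> coef f x = 0.
Proof.
have : `[< finite_support (val f) >] := submodule_mem f.
move=> /asboolP[s sP]; exists (undup s); split; first exact: undup_uniq.
by move=> x; rewrite mem_undup; exact: sP.
Qed.

Definition total (f : free_module) : P :=
  \sum_(x <- sval (cid (finite_supportP f))) coef f x *: x.

Lemma totalE (f : free_module) (s : seq P) : uniq s ->
  (forall x, x \notin s -> coef f x = 0) -> total f = \sum_(x <- s) coef f x *: x.
Proof.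
rewrite /total; case: cid => t [tu tf] /= su sf.
rewrite (bigID (fun x => coef f x != 0)) /= [X in _ + X]big1 ?addr0; last first.
  by move=> x /negPn/eqP ->; rewrite scale0r.
rewrite [RHS](bigID (fun x => coef f x != 0)) /= [X in _ = _ + X]big1 ?addr0; last first.
  by move=> x /negPn/eqP ->; rewrite scale0r.
rewrite -big_filter -[RHS]big_filter; apply: perm_big.
apply: uniq_perm; rewrite ?filter_uniq // => x; rewrite !mem_filter.
have [//|fx] := eqVneq (coef f x) 0.
have -> : x \in t by apply: contraNT fx => /tf ->.
by have -> : x \in s by apply: contraNT fx => /sf ->.
Qed.

Fact total_linear : linear total.
Proof.
move=> a f g; have [s [su sf]] := finite_supportP f.
have [t [tu tg]] := finite_supportP g.
pose u := undup (s ++ t).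
have uu : uniq u by exact: undup_uniq.
have uf x : x \notin u -> coef f x = 0.
  by rewrite mem_undup mem_cat negb_or => /andP[/sf].
have ug x : x \notin u -> coef g x = 0.
  by rewrite mem_undup mem_cat negb_or => /andP[_ /tg].
have fgE x : coef (a *: f + g) x = a * coef f x + coef g x by [].
rewrite (totalE uu uf) (totalE uu ug) (totalE uu); last first.
  by move=> x xu; rewrite fgE uf // ug // mulr0 addr0.
rewrite scaler_sumr -big_split; apply: eq_bigr => x _ /=.
by rewrite fgE scalerDl scalerA.
Qed.

Lemma total_surj y : exists f, mk_linear total_linear f = y.
Proof.
have yS : (fun x => (x == y)%:R : R^o) \in
    prop_submod finite_support0 finite_supportD finite_supportZ.
  rewrite mem_prop_submod; apply/asboolP; exists [:: y] => x.
  by rewrite inE => /negPf ->.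
exists (Submodule yS); rewrite /= (@totalE _ [:: y]) ?big_seq1 /coef /= ?eqxx ?scale1r //.
by move=> x; rewrite inE => /negPf /= ->.
Qed.

Lemma dual_basis : projective P -> exists phi : P -> {linear P -> R^o},
  forall x, exists s : seq P, x = \sum_(p <- s) (phi p x : R) *: p.
Proof.
move=> pP.
have [h hE] := pP _ _ (mk_linear total_linear)
  (GRing.Linear.clone _ _ _ _ idfun _) total_surj.
have L p : linear (fun x => coef (h x) p : R^o).
  by move=> a x y; rewrite linearP.
exists (fun p => mk_linear (L p)) => x; have [s [su sP]] := finite_supportP (h x).
by exists s; rewrite -[LHS](hE x) /= (totalE su sP).
Qed.

End DualBasis.

Section Ideals.
Variable R : comNzRingType.

(** [Prop]-valued sets suit ideals cut out by existential formulas and families ordered by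
    inclusion; [ideal_submod] leads back to submodules. *)
Definition is_ideal (I : set R) :=
  [/\ I 0, forall x y, I x -> I y -> I (x + y) & forall a x, I x -> I (a * x)].

Definition ideal_submod (I : set R) (hI : is_ideal I) : submodClosed R^o :=
  let: And3 I0 ID IM := hI in @prop_submod R R^o I I0 ID IM.

Lemma mem_ideal_submod I (hI : is_ideal I) x : x \in ideal_submod hI <-> I x.
Proof. by case: hI => ? ? ?; rewrite mem_prop_submod; split=> /asboolP. Qed.

Lemma exists_ideal_submod (I : set R) : is_ideal I ->
  exists J : submodClosed R^o, forall x : R, x \in J <-> I x.
Proof. by move=> hI; exists (ideal_submod hI) => x; exact: mem_ideal_submod. Qed.

Lemma submod_is_ideal (I : submodClosed R^o) : is_ideal [set x : R | x \in I].
Proof.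
split=> [|x y|a x]; [exact: (@rpred0 _ I) | exact: (@rpredD _ I) |].
exact: (@rpredZ _ _ I).
Qed.

Lemma ideal_sum I (hI : is_ideal I) T (s : seq T) (p : pred T) (F : T -> R) :
  (forall i, p i -> I (F i)) -> I (\sum_(i <- s | p i) F i).
Proof. by case: hI => I0 ID _ h; apply: big_ind. Qed.

Definition fg_ideal (I : set R) := exists n (g : 'I_n -> R),
  (forall i, I (g i)) /\ forall x, I x -> exists c : 'I_n -> R, x = \sum_i c i * g i.

Definition noetherian := forall I, is_ideal I -> fg_ideal I.

Lemma noetherian_max (F : set (set R)) : noetherian ->
  F !=set0 -> (forall I, F I -> is_ideal I) ->
  exists I, F I /\ forall J, F J -> I `<=` J -> J = I.
Proof.
move=> noeth [I0 FI0] Fid.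
have [|A [PA Amax]] := @Zorn_bigcup R [set I | F I \/ I = set0].
  move=> C CP Ctot; case: (pselect (exists I x, C I /\ I x)) => [[I [x [CI Ix]]]|nC].
  - left; pose U := \bigcup_(X in C) X.
    have CF X y : C X -> X y -> F X.
      by move=> CX Xy; case: (CP _ CX) => // X0; move: Xy; rewrite X0.
    have FI := CF _ _ CI Ix; have [_ _ IM] := Fid _ FI.
    have [|n [g [gU gP]]] := noeth U.
      split; first by exists I => //; rewrite -(mul0r x); exact: IM.
        move=> y z [X CX Xy] [Y CY Yz].
        have [_ XD _] := Fid _ (CF _ _ CX Xy).
        have [_ YD _] := Fid _ (CF _ _ CY Yz).
        have [XY|YX] := Ctot _ _ CX CY.
          by exists Y => //; apply: YD => //; exact: XY.
        by exists X => //; apply: XD => //; exact: YX.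
      move=> a y [X CX Xy]; exists X => //.
      by have [_ _] := Fid _ (CF _ _ CX Xy); exact.
    (* The finitely many generators of the union already lie in one member of the chain. *)
    have [X [CX [FX Xg]]] : exists X, C X /\ (F X /\ forall i, X (g i)).
      suff : forall s : seq 'I_n, exists X, C X /\ (F X /\ forall i, i \in s -> X (g i)).
        move=> /(_ (enum 'I_n))[X [CX [FX Xg]]]; exists X; split=> //; split=> // i.
        by apply: Xg; rewrite mem_enum.
      elim=> [|i s [X [CX [FX Xs]]]]; first by exists I.
      have [Y CY Yi] := gU i; have FY := CF _ _ CY Yi.
      have [XY|YX] := Ctot _ _ CX CY.
        exists Y; split=> //; split=> // j; rewrite inE => /orP[/eqP -> //|/Xs].
        exact: XY.
      exists X; split=> //; split=> // j; rewrite inE => /orP[/eqP ->|/Xs //].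
      exact: YX.
    suff -> : \bigcup_(X in C) X = X by [].
    apply/seteqP; split=> y; last by move=> Xy; exists X.
    move=> /gP[c ->]; apply: (ideal_sum (Fid _ FX)) => i _.
    by have [_ _] := Fid _ FX; exact.
  - right; apply/seteqP; split=> // y [I CI Iy]; apply: nC; by exists I, y.
have FA : F A.
  case: PA => // AE; exfalso; apply: (Amax I0); last by left.
  rewrite AE; split=> // /(_ 0); apply.
  by have [] := Fid _ FI0.
exists A; split=> // J FJ AJ; apply: contrapT => JA; apply: (Amax J); last by left.
by split=> // JA'; apply: JA; apply/seteqP; split.
Qed.

Definition maximal_ideal (m : set R) := [/\ is_ideal m, ~ m 1 &
  forall J, is_ideal J -> ~ J 1 -> m `<=` J -> J = m].

Lemma exists_maximal_ideal I : noetherian -> is_ideal I -> ~ I 1 ->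
  exists m, maximal_ideal m /\ I `<=` m.
Proof.
move=> noeth hI I1.
have [||m [[hm m1 Im] mmax]] :=
    @noetherian_max [set J | [/\ is_ideal J, ~ J 1 & I `<=` J]] noeth.
- by exists I; split.
- by move=> J [].
exists m; split=> //; split=> // J hJ J1 mJ; apply: mmax => //; split=> //.
exact: subset_trans mJ.
Qed.

Lemma ideal_add I x : is_ideal I -> is_ideal [set z | exists a i, I i /\ z = a * x + i].
Proof.
move=> [I0 ID IM]; split=> [|_ _ [a [i [Ii ->]]] [b [j [Ij ->]]]|b _ [a [i [Ii ->]]]].
- by exists 0, 0; rewrite mul0r addr0.
- by exists (a + b), (i + j); split; [exact: ID | ring].
- by exists (b * a), (b * i); split; [exact: IM | ring].
Qed.

Lemma maximal_idealP m : maximal_ideal m ->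
  forall x, ~ m x -> exists a i, m i /\ 1 = a * x + i.
Proof.
move=> [hm m1 mmax] x mx; apply: contrapT => h; apply: mx.
rewrite -(mmax _ (ideal_add x hm) h).
  by exists 1, 0; rewrite mul1r addr0; case: hm.
by move=> y my; exists 0, y; rewrite mul0r add0r.
Qed.

Lemma maximal_idealM m : maximal_ideal m -> forall x y, m (x * y) -> m x \/ m y.
Proof.
move=> mm x y mxy; case: (pselect (m x)) => mx; [by left | right].
have [[_ mD mM] _ _] := mm; have [a [i [mi E]]] := maximal_idealP mm mx.
have -> : y = a * (x * y) + y * i by rewrite -{1}[y]mul1r E; ring.
by apply: mD; exact: mM.
Qed.

End Ideals.

(** * Ideals of Dedekind domains *)

Section Dedekind.
Variable R : idomainType.
Hypothesis R_dedekind : dedekind R.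

(** As [d * phi x = x * phi d] for a functional [phi], each [phi] is multiplication by [phi d / d].
    The support of [d] serves all [x] at once: expand [d], multiply by [x] and cancel [d]. *)
Lemma ideal_dual_basis (I : set R) d : is_ideal I -> I d -> d != 0 ->
  exists n (g c : 'I_n -> R), [/\ forall i, I (g i), d = \sum_i c i * g i &
    forall x, I x -> exists h : 'I_n -> R,
      (forall i, c i * x = d * h i) /\ x = \sum_i h i * g i].
Proof.
move=> hI Id d0.
pose IS := ideal_submod hI.
have [phi phiP] := dual_basis (@R_dedekind IS).
have dS : d \in IS by exact/mem_ideal_submod.
have phiE (x : R) (xS : x \in IS) p :
    (phi p (Submodule dS) : R) * x = d * (phi p (Submodule xS) : R).
  have E : (x : R) *: Submodule dS = d *: Submodule xS.
    by apply: val_inj; exact: mulrC.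
  rewrite mulrC; apply: etrans (esym (lin_scale (phi p) x _)) _.
  exact: etrans (congr1 (phi p) E) (lin_scale (phi p) d _).
have [s sE] := phiP (Submodule dS).
have dE : d = \sum_(p <- s) (phi p (Submodule dS) : R) * (val p : R).
  have := congr1 (from_submodule IS) sE; rewrite linear_sum /= => {1}->.
  by apply: eq_bigr.
pose q i := nth (Submodule dS) s i.
exists (size s), (fun i => val (q i) : R), (fun i => phi (q i) (Submodule dS) : R).
have dE' : d = \sum_(i < size s)
    (phi (q i) (Submodule dS) : R) * (val (q i) : R).
  by rewrite {1}dE (big_nth (Submodule dS)) big_mkord.
split=> // [i|x Ix]; first by apply/mem_ideal_submod; exact: submodule_mem.
have xS : x \in IS by exact/mem_ideal_submod.
exists (fun i => phi (q i) (Submodule xS) : R); split=> [i|]; first exact: phiE.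
apply: (mulfI d0); rewrite {1}dE' mulr_suml mulr_sumr; apply: eq_bigr => i _.
by rewrite mulrAC phiE mulrA.
Qed.

(** The ideal quotient [(dR : I)]. For a nonzero [d] in [I] it is [d I^{-1}], an inverse of [I] up
    to [d] that stays inside [R]. *)
Definition colon (d : R) (I : set R) : set R :=
  [set c | forall x, I x -> exists y, c * x = d * y].

Lemma colon_ideal d I : is_ideal (colon d I).
Proof.
split=> [x _|x y hx hy z Iz|a x hx z Iz]; first by exists 0; rewrite mul0r mulr0.
  have [u uE] := hx z Iz; have [v vE] := hy z Iz.
  by exists (u + v); rewrite mulrDl uE vE mulrDr.
by have [u uE] := hx z Iz; exists (a * u); rewrite -mulrA uE mulrCA.
Qed.

Lemma colon_self d I : colon d I d.
Proof. by move=> x _; exists x. Qed.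

Lemma colon_sub d I J : I `<=` J -> colon d J `<=` colon d I.
Proof. by move=> IJ c hc x /IJ; exact: hc. Qed.

Lemma ideal_inverse (I : set R) d : is_ideal I -> I d -> d != 0 ->
  exists n (g c : 'I_n -> R),
  [/\ forall i, I (g i), forall i, colon d I (c i) & d = \sum_i c i * g i].
Proof.
move=> hI Id d0; have [n [g [c [Ig dE h]]]] := ideal_dual_basis hI Id d0.
exists n, g, c; split=> // i x /h[y [yE _]]; exists (y i); exact: yE.
Qed.

Lemma dedekind_noetherian : noetherian R.
Proof.
move=> I hI; case: (pselect (exists2 d, I d & d != 0)) => [[d Id d0]|nI].
  have [n [g [c [Ig dE h]]]] := ideal_dual_basis hI Id d0.
  by exists n, g; split=> // x /h[y [_ yE]]; exists y.
exists 0%N, (fun=> 0); split=> [[]//|x Ix]; exists (fun=> 0).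
rewrite big_ord0; apply: contrapT => x0; apply: nI; exists x => //.
exact/eqP.
Qed.

(** If [d = sum c_i g_i] and [z c_i = d h_i], then [d z = d sum h_i g_i]. Thus [colon d] is an
    inclusion-reversing involution on the ideals containing [d]. *)
Lemma colonK d (I : set R) : is_ideal I -> I d -> d != 0 -> colon d (colon d I) = I.
Proof.
move=> hI Id d0; apply/seteqP; split=> [z hz|z Iz c hc]; last first.
  by have [y yE] := hc z Iz; exists y; rewrite mulrC.
have [n [g [c [Ig Cc dE]]]] := ideal_inverse hI Id d0.
have [h hE] : exists h : 'I_n -> R, forall i, z * c i = d * h i.
  exists (fun i => sval (cid (hz _ (Cc i)))) => i.
  by case: cid.
have -> : z = \sum_i h i * g i.
  apply: (mulfI d0); rewrite {1}dE mulr_suml mulr_sumr; apply: eq_bigr => i _.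
  by rewrite [RHS]mulrA -hE; ring.
by apply: (ideal_sum hI) => i _; case: hI => _ _; exact.
Qed.

(* The quotient by a nonzero ideal is Artinian: the colon ideals of a descending
   chain of ideals containing a fixed [d != 0] form an ascending chain. *)
Lemma pi_regular (I : set R) d s : is_ideal I -> I d -> d != 0 ->
  exists k c, I (s ^+ k - c * s ^+ k.+1).
Proof.
move=> hI Id d0.
pose J k := [set z | exists a i, I i /\ z = a * s ^+ k + i].
have hJ k : is_ideal (J k) by exact: ideal_add.
have Jd k : J k d by exists 0, d; rewrite mul0r add0r.
have JS k : J k.+1 `<=` J k.
  by move=> _ [a [i [Ii ->]]]; exists (a * s), i; rewrite exprS mulrA.
have [||_ [[k _ <-] kmax]] :=
    @noetherian_max _ [set colon d (J k) | k in setT] dedekind_noetherian.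
- by exists (colon d (J 0%N)), 0%N.
- by move=> _ [k _ <-]; exact: colon_ideal.
have /(congr1 (colon d)) := kmax _ (ex_intro2 _ _ k.+1 Logic.I erefl) (colon_sub (JS k)).
rewrite !colonK // => JE.
have : J k.+1 (s ^+ k).
  by rewrite JE; exists 1, 0; rewrite mul1r addr0; case: hI.
by move=> [c [i [Ii E]]]; exists k, c; rewrite {1}E addrC addKr.
Qed.

(** Iterating [s^k = c s^(k+1)] modulo [I] gives [s^k = c^k s^(2k)]. Hence [e = c^k s^k] is
    idempotent modulo [I] and [s^k = s^k e], so a maximal ideal above [I] that contains [e] contains
    [s]. *)
Lemma idempotent_multiple (I : set R) d s : is_ideal I -> I d -> d != 0 ->
  exists c, I ((s * c) ^+ 2 - s * c) /\
    forall m, maximal_ideal m -> I `<=` m -> m (s * c) -> m s.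
Proof.
move=> hI Id d0; have [l [c lc]] := pi_regular s hI Id d0.
have [I0 ID IM] := hI.
(* Raising the exponent by one makes it positive, so that [c ^+ k * s ^+ k] is a multiple of [s]. *)
have {lc}[k [k0 kc]] : exists k, (0 < k)%N /\ I (s ^+ k - c * s ^+ k.+1).
  exists l.+1; split=> //.
  have -> : s ^+ l.+1 - c * s ^+ l.+2 = s * (s ^+ l - c * s ^+ l.+1).
    by rewrite !exprS; ring.
  exact: IM.
have kj j : I (s ^+ k - c ^+ j * s ^+ (k + j)).
  elim: j => [|j IH]; first by rewrite expr0 mul1r addn0 subrr.
  have -> : s ^+ k - c ^+ j.+1 * s ^+ (k + j.+1) =
      (s ^+ k - c ^+ j * s ^+ (k + j)) +
      (c ^+ j * s ^+ j) * (s ^+ k - c * s ^+ k.+1).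
    by rewrite !exprD !exprS; ring.
  by apply: ID => //; exact: IM.
exists (s ^+ k.-1 * c ^+ k).
have E : s * (s ^+ k.-1 * c ^+ k) = c ^+ k * s ^+ k.
  by rewrite mulrA -exprS prednK // mulrC.
rewrite E; split.
  have -> : (c ^+ k * s ^+ k) ^+ 2 - c ^+ k * s ^+ k =
      (- c ^+ k) * (s ^+ k - c ^+ k * s ^+ (k + k)) by rewrite exprD; ring.
  exact/IM/kj.
move=> m mm Im mE; have [[m0 mD mM] m1 _] := mm.
have : m (s ^+ k).
  have -> : s ^+ k = (s ^+ k - c ^+ k * s ^+ (k + k)) +
      s ^+ k * (c ^+ k * s ^+ k) by rewrite exprD; ring.
  by apply: mD; [exact/Im/kj | exact: mM].
elim: (k) => [|j IH]; first by rewrite expr0 => /m1.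
by rewrite exprS => /(maximal_idealM mm)[].
Qed.

(* The elements fixed modulo [I] by some idempotent in [G] form an ideal, which
   is contained in no maximal ideal. *)
Lemma semilocal_glue (I : set R) d (G : set R) : is_ideal I -> I d -> d != 0 -> G 0 ->
  (forall e e', G e -> G e' -> I (e ^+ 2 - e) -> I (e' ^+ 2 - e') ->
    G (e + (1 - e) * e')) ->
  (forall m, maximal_ideal m -> I `<=` m -> exists s, ~ m s /\
    forall c, G (s * c)) ->
  exists u, G u /\ I (1 - u).
Proof.
move=> hI Id d0 G0 GD Gm; have [I0 ID IM] := hI.
pose J := [set x | exists e, [/\ G e, I (e ^+ 2 - e) & I ((1 - e) * x)]].
have IJ : I `<=` J.
  by move=> x Ix; exists 0; split=> //; rewrite ?expr0n ?subr0 // mul1r.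
have hJ : is_ideal J.
  split; first exact: IJ.
    move=> x y [e [Ge ie ex]] [f [Gf jf fy]]; exists (e + (1 - e) * f).
    (* [1 - (e + (1 - e) * f)] is [(1 - e) * (1 - f)]: the new idempotent fixes whatever [e] or [f]
       fixes. *)
    split; first exact: GD.
      have -> : (e + (1 - e) * f) ^+ 2 - (e + (1 - e) * f) =
        (1 - f) ^+ 2 * (e ^+ 2 - e) + (1 - e) * (f ^+ 2 - f) by ring.
      by apply: ID; exact: IM.
    have -> : (1 - (e + (1 - e) * f)) * (x + y) =
      (1 - f) * ((1 - e) * x) + (1 - e) * ((1 - f) * y) by ring.
    by apply: ID; exact: IM.
  move=> a x [e [Ge ie ex]]; exists e; split=> //.
  by rewrite mulrCA; exact: IM.
case: (pselect (J 1)) => [[e [Ge _ e1]]|J1].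
  by exists e; split=> //; rewrite -[1 - e]mulr1.
have [m [mm Jm]] := exists_maximal_ideal dedekind_noetherian hJ J1.
have Im : I `<=` m by exact: subset_trans Jm.
have [s [ms Gs]] := Gm m mm Im.
have [c [ic cm]] := idempotent_multiple s hI Id d0.
(* The idempotent [s * c] fixes itself, so it lies in [J], hence in [m], which forces [s] into
   [m]. *)
exfalso; apply/ms/(cm _ mm Im)/Jm; exists (s * c); split=> //.
have -> : (1 - s * c) * (s * c) = -1 * ((s * c) ^+ 2 - s * c) by ring.
exact: IM.
Qed.

(* The ideal [(b / d) J] is isomorphic to [J] and coprime to [I]. *)
Lemma coprime_representative (I J : set R) : is_ideal I -> is_ideal J ->
  (exists2 a, I a & a != 0) -> (exists2 a, J a & a != 0) ->
  exists d b, [/\ d != 0, b != 0, colon d J b &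
    exists i j x, [/\ I i, J j, d * x = b * j & i + x = 1]].
Proof.
move=> hI hJ [a Ia a0] [d Jd d0].
have [I0 ID IM] := hI; have [J0 JD JM] := hJ.
have [C0 CD CM] := colon_ideal d J.
(* Elements of [G] are congruent modulo [I] to some [x = b j / d] in [(b / d) J]; one that is
   congruent to [1] makes this ideal coprime to [I]. *)
pose G := [set e | exists b j x, [/\ colon d J b, J j, I (e - x) & d * x = b * j]].
have [|||u [[b [j [x [Cb Jj ux E]]]] u1]] := @semilocal_glue I a G hI Ia a0.
- by exists 0, 0, 0; rewrite subr0 mulr0 mul0r; split.
- move=> e1 e2 [b1 [j1 [x1 [Cb1 Jj1 Ix1 E1]]]] [b2 [j2 [x2 [Cb2 Jj2 Ix2 E2]]]] I1 I2.
  have [y1 y1E] := Cb1 _ Jj2; have [y2 y2E] := Cb2 _ Jj1.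
  (* The third witness is the expansion of the product of these two divided by [d], with
     [y1 = b1 j2 / d] and [y2 = b2 j1 / d]; the mixed terms carry [e1 * (1 - e1)], which lies in
     [I]. *)
  exists (e1 * b1 + (1 - e1) * e2 * b2), (e1 * j1 + (1 - e1) * j2).
  exists (e1 ^+ 2 * x1 + (1 - e1) ^+ 2 * e2 * x2 + e1 * (1 - e1) * (y1 + e2 * y2)).
  split; [by apply: CD; exact: CM | by apply: JD; exact: JM | |].
    have -> : e1 + (1 - e1) * e2 - (e1 ^+ 2 * x1 + (1 - e1) ^+ 2 * e2 * x2 +
       e1 * (1 - e1) * (y1 + e2 * y2)) =
      (e1 ^+ 2 * (e1 - x1) + (1 - e1) ^+ 2 * e2 * (e2 - x2)) +
      ((y1 + e2 * y2 - 1 - e1 - e2 ^+ 2) * (e1 ^+ 2 - e1) +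
       (e1 - 1) * (e2 ^+ 2 - e2)) by ring.
    by apply: (ID); apply: ID; exact: IM.
  transitivity (e1 ^+ 2 * (d * x1) + (1 - e1) ^+ 2 * e2 * (d * x2) +
    e1 * (1 - e1) * (d * y1 + e2 * (d * y2))); first by ring.
  by rewrite E1 E2 -y1E -y2E; ring.
- move=> m [[m0 mD mM] m1 _] Im.
  (* The elements [h i = c i * g i / d] add up to [1], so one of them is outside [m]; it lies in
     [(c i / d) J]. *)
  have [n [g [c [Jg Cc dE]]]] := ideal_inverse hJ Jd d0.
  have [h hE] : exists h : 'I_n -> R, forall i, c i * g i = d * h i.
    exists (fun i => sval (cid (Cc i _ (Jg i)))) => i.
    by case: cid.
  have h1 : \sum_i h i = 1.
    apply: (mulfI d0); rewrite mulr1 {2}dE mulr_sumr.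
    by apply: eq_bigr => i _; rewrite hE.
  have [i mi] : exists i, ~ m (h i).
    apply: contrapT => nh; apply: m1; rewrite -h1.
    apply: (@ideal_sum _ m) => // i _; apply: contrapT => mi; apply: nh; by exists i.
  exists (h i); split=> // r; exists (r * c i), (g i), (h i * r).
  split=> //; first exact: CM.
    by rewrite subrr.
  by rewrite -mulrA hE; ring.
have {}u1 : I (1 - x).
  have -> : 1 - x = (1 - u) + (u - x) by ring.
  exact: ID.
(* If [b = 0] then [x = 0] and [1] lies in [I], so [J] itself will do: [b = d]. *)
have [b0|b0] := eqVneq b 0; last first.
  by exists d, b; split=> //; exists (1 - x), j, x; split; rewrite ?subrK.
exists d, d; split=> //; first exact: colon_self.
exists 1, 0, 0; rewrite !mulr0 addr0; split=> //.
have : d * x = 0 by rewrite E b0 mul0r.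
by move=> /eqP; rewrite mulf_eq0 (negPf d0) /= => /eqP x0; move: u1; rewrite x0 subr0.
Qed.

End Dedekind.

(** * Ideal classes and determinants *)

Section IdealClasses.
Variable R : idomainType.
Implicit Types I J L : submodClosed R^o.

Definition nonzero_ideal I := exists2 a : R, a \in I & a != 0.

Lemma mem_ideal_class I (nzI : nonzero_ideal I) J (nzJ : nonzero_ideal J) :
  ideal_class nzI = ideal_class nzJ <-> exists a b : R, [/\ a != 0, b != 0,
    forall x : R, x \in I -> exists2 y : R, y \in J & a * x = b * y &
    forall y : R, y \in J -> exists2 x : R, x \in I & a * x = b * y].
Proof.
split.
  move=> /eqmodP/asboolP[a [b [a0 b0 E]]]; exists a, b; split=> // x xI.
    have : [set a%:F * x | x in [set a%:F | a in [set a : R | a \in I]]] (a * x)%:F.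
      by exists x%:F; [exists x | rewrite tofracM].
    rewrite E => -[_ [y yJ <-]]; rewrite -tofracM => /eqP.
    by rewrite tofrac_eq => /eqP <-; exists y.
  have : [set b%:F * x | x in [set a%:F | a in [set a : R | a \in J]]] (b * x)%:F.
    by exists x%:F; [exists x | rewrite tofracM].
  rewrite -E => -[_ [y yJ <-]]; rewrite -tofracM => /eqP.
  by rewrite tofrac_eq => /eqP <-; exists y.
move=> [a [b [a0 b0 IJ JI]]]; apply/eqmodP/asboolP; exists a, b; split=> //.
apply/seteqP; split=> _ [_ [x xI <-] <-] /=.
  have [y yJ E] := IJ x xI.
  by exists y%:F; [exists y | rewrite -!tofracM E].
have [y yJ E] := JI x xI.
by exists y%:F; [exists y | rewrite -!tofracM E].
Qed.

(** Multiplication by [a / b]: values are obtained by choice, and linearity follows by cancelling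
    [b]. *)
Lemma ideal_class_iso I (nzI : nonzero_ideal I) J (nzJ : nonzero_ideal J) :
  ideal_class nzI = ideal_class nzJ -> isomorphic (submodule I) (submodule J).
Proof.
move=> /mem_ideal_class[a [b [a0 b0 IJ JI]]].
have [f fP] : exists f : submodule I -> submodule J,
    forall x : submodule I, a * (submodule_val x : R) = b * (submodule_val (f x) : R).
  suff h : forall x : submodule I, {y : submodule J |
      a * (submodule_val x : R) = b * (submodule_val y : R)}.
    by exists (fun x => sval (h x)) => x; case: (h x).
  move=> [x xI]; have /cid2[y yJ E] := IJ x xI.
  by exists (Submodule yJ).
have [g gP] : exists g : submodule J -> submodule I,
    forall y : submodule J, a * (submodule_val (g y) : R) = b * (submodule_val y : R).
  suff h : forall y : submodule J, {x : submodule I |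
      a * (submodule_val x : R) = b * (submodule_val y : R)}.
    by exists (fun y => sval (h y)) => y; case: (h y).
  move=> [y yJ]; have /cid2[x xI E] := JI y yJ.
  by exists (Submodule xI).
have L : linear f.
  move=> c x y; apply: val_inj; apply: (mulfI b0).
  change (b * (submodule_val (f (c *: x + y)) : R) =
    b * (c * (submodule_val (f x) : R) + (submodule_val (f y) : R))).
  rewrite mulrDr mulrCA -!fP -mulrCA -mulrDr; congr (a * _).
exists (mk_linear L), g => [x|y]; apply: val_inj.
  by apply: (mulfI a0); apply: etrans (gP _) (esym (fP _)).
by apply: (mulfI b0); apply: etrans (esym (fP _)) (gP _).
Qed.

(** The intersection of coprime ideals is their product: [z = x z + z y] for [z] in both. *)
Lemma ideal_class_coprime I (nzI : nonzero_ideal I) J (nzJ : nonzero_ideal J)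
    L (nzL : nonzero_ideal L) (x y : R) :
  x \in I -> y \in J -> x + y = 1 ->
  (forall z : R, (z \in L) = (z \in I) && (z \in J)) ->
  ideal_class nzL = (ideal_class nzI * ideal_class nzJ)%g.
Proof.
move=> xI yJ xy LE; apply: etrans (esym (Pic_mulE _ _)).
congr fideal_class; apply: fractional_ideal_inj; apply/seteqP; split=> /=.
  move=> _ [z + <-]; rewrite /= LE => /andP[zI zJ].
  have -> : z%:F = x%:F * z%:F + z%:F * y%:F.
    by rewrite [z%:F * y%:F]mulrC -mulrDl -tofracD xy tofrac1 mul1r.
  apply: (fideal_prod_closed _ _).2; apply: fideal_prod_mem;
    by [exists x | exists z | exists y].
apply: fideal_prod_sub.
  split=> [|_ _ [u uL <-] [v vL <-]].
    by exists 0; rewrite ?tofrac0 //; exact: (@rpred0 _ L).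
  by exists (u + v); rewrite ?tofracD //; exact: (@rpredD _ L).
move=> _ _ [u uI <-] [v vJ <-]; exists (u * v); last by rewrite tofracM.
rewrite /= LE; apply/andP; split; last exact: (@rpredZ _ _ J).
by rewrite mulrC; exact: (@rpredZ _ _ I).
Qed.

Section Coordinates.
Variables (n : nat) (I : submodClosed R^o).
Local Notation V := ({ffun 'I_n -> R^o} * submodule I)%type.

Definition coords (v : V) : {ffun 'I_n.+1 -> R^o} :=
  [ffun i => oapp v.1 (submodule_val v.2) (unlift ord_max i)].

Fact coords_linear : linear coords.
Proof.
move=> a u v; apply/ffunP => i; rewrite !ffunE.
by case: unliftP => [j _|_] /=; rewrite ?ffunE.
Qed.

Lemma coordsZ a v j : (coords (a *: v) j : R) = a * (coords v j : R).
Proof. by rewrite !ffunE; case: unliftP => [k _|_] //=; rewrite ffunE. Qed.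

Lemma coords_sum m (c : 'I_m -> R) (v : 'I_m -> V) j :
  (coords (\sum_i c i *: v i) j : R) = \sum_i c i * (coords (v i) j : R).
Proof.
have L : linear (fun v => coords v j : R^o).
  by move=> a u w; rewrite coords_linear !ffunE.
apply: etrans (linear_sum (mk_linear L) _ _ _) _.
by apply: eq_bigr => i _; exact: coordsZ.
Qed.

Lemma coords_inj : injective coords.
Proof.
move=> [u y] [v z] /ffunP E; congr pair.
  by apply/ffunP => i; have := E (lift ord_max i); rewrite !ffunE liftK.
by apply: val_inj; have := E ord_max; rewrite !ffunE unlift_none.
Qed.

(* The module [R^n + I] lacks the last unit vector of R^(n+1): with [y = a] these
   are the vectors [a e_i], for [a] in [I], so that matrices keep entries in R. *)
Definition coord_vec (a : R) (y : submodule I) (i : 'I_n.+1) : V :=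
  if unlift ord_max i is Some j then ([ffun k => (k == j)%:R * a], 0) else (0, y).

Lemma coords_vec (a : R) (aI : a \in I) i j :
  coords (coord_vec a (Submodule aI) i) j = (i == j)%:R * a.
Proof.
rewrite ffunE /coord_vec; case: (unliftP ord_max i) => [i' ->|->] /=.
  case: (unliftP ord_max j) => [j' ->|->] /=.
    by rewrite ffunE (inj_eq lift_inj) eq_sym.
  by rewrite eq_sym (negPf (neq_lift _ _)) mul0r.
case: (unliftP ord_max j) => [j' ->|->] /=; last by rewrite eqxx mul1r.
by rewrite ffunE (negPf (neq_lift _ _)) mul0r.
Qed.

Lemma coord_vecE (a : R) (aI : a \in I) (v : V) :
  a *: v = \sum_i (coords v i : R) *: coord_vec a (Submodule aI) i.
Proof.
apply/coords_inj/ffunP => j; apply: etrans (coordsZ _ _ _) _.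
apply: etrans _ (esym (coords_sum _ _ _)).
rewrite (bigD1 j) //= big1 ?addr0 => [|i ij].
  by rewrite coords_vec eqxx mul1r mulrC.
by rewrite coords_vec (negPf ij) mul0r mulr0.
Qed.

End Coordinates.

Section Determinant.
Variables (n : nat) (I J : submodClosed R^o).
Variable f : {linear ({ffun 'I_n -> R^o} * submodule I)%type ->
  ({ffun 'I_n -> R^o} * submodule J)%type}.

(** If [F] is the matrix of [f] over the fraction field, then [y = a] gives [a F], while [a = 1]
    multiplies only the last row of [F] by [y]. *)
Definition iso_mx (a : R) (y : submodule I) : 'M[R]_n.+1 :=
  \matrix_(i, j) (coords (f (coord_vec a y i)) j : R).

Lemma iso_mxP (a : R) (aI : a \in I) v j :
  a * (coords (f v) j : R) =
  \sum_i (coords v i : R) * iso_mx a (Submodule aI) i j.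
Proof.
have := congr1 (fun w => coords (f w) j : R) (coord_vecE aI v).
rewrite linearZ linear_sum coordsZ => ->.
have -> : \sum_i f ((coords v i : R) *: coord_vec a (Submodule aI) i) =
    \sum_i (coords v i : R) *: f (coord_vec a (Submodule aI) i).
  by apply: eq_bigr => i _; rewrite linearZ.
by rewrite coords_sum; apply: eq_bigr => i _; rewrite mxE.
Qed.

(* Over the fraction field, [f] has determinant [det (iso_mx a a) / a ^ (n + 1)];
   the lemma says that it multiplies [I] into [J]. *)
Lemma det_iso_mx (a : R) (aI : a \in I) (y : R) : y \in I ->
  exists2 z : R, z \in J & \det (iso_mx a (Submodule aI)) * y = a ^+ n.+1 * z.
Proof.
(* This is [det F * y]. The last column has entries in [J], so expanding along it puts the
   determinant in [J]. *)
move=> yI; exists (\det (iso_mx 1 (Submodule yI))).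
  rewrite (expand_det_col _ ord_max).
  apply: (@rpred_sum _ J) => i _; rewrite mulrC; apply: (@rpredZ _ _ J).
  by rewrite mxE ffunE unlift_none; exact: submodule_mem.
rewrite -detZ.
rewrite (@determinant_multilinear _ _ _ (iso_mx a (Submodule aI))
  (iso_mx a (Submodule aI)) ord_max y 0) ?mul0r ?addr0 1?mulrC //.
- rewrite scale0r addr0; apply/rowP => j; rewrite !mxE /coord_vec unlift_none.
  rewrite -!coordsZ -!linearZ; congr (coords (f _) j : R).
  congr pair; first by rewrite /= !scaler0.
  by apply: val_inj; exact: mulrC.
all: apply/matrixP => i j; rewrite !mxE /coord_vec liftK -coordsZ -linearZ.
all: congr (coords (f _) j : R); congr pair; rewrite /= ?scaler0 //.
all: by apply/ffunP => k; rewrite !ffunE mulr1; exact: mulrC.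
Qed.

End Determinant.

Lemma ideal_class_uniq n I (nzI : nonzero_ideal I) J (nzJ : nonzero_ideal J) :
  isomorphic ({ffun 'I_n -> R^o} * submodule I)%type
             ({ffun 'I_n -> R^o} * submodule J)%type ->
  ideal_class nzI = ideal_class nzJ.
Proof.
move=> /isomorphicP[f [g [fK gK]]]; have [a aI a0] := nzI; have [b bJ b0] := nzJ.
pose A := iso_mx f a (Submodule aI); pose B := iso_mx g b (Submodule bJ).
(* [A] and [B] are [a] and [b] times mutually inverse matrices over the fraction field, so the
   determinant of [g] inverts that of [f] and takes [J] back into [I]. *)
have AB : A *m B = (a * b)%:M.
  apply/matrixP => i j; rewrite !mxE.
  transitivity (\sum_k (coords (f (coord_vec a (Submodule aI) i)) k : R) * B k j).
    by apply: eq_bigr => k _; rewrite mxE.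
  rewrite -iso_mxP fK coords_vec; case: eqP => _; rewrite ?mul1r ?mul0r ?mulr0 //.
  exact: mulrC.
have dAB : \det A * \det B = (a * b) ^+ n.+1 by rewrite -det_mulmx AB det_scalar.
have dA0 : \det A != 0.
  apply/eqP => dA; move: dAB; rewrite dA mul0r => /esym/eqP.
  by rewrite expf_eq0 mulf_eq0 (negPf a0) (negPf b0).
apply/mem_ideal_class; exists (\det A), (a ^+ n.+1); split=> //.
- by rewrite expf_eq0 (negPf a0).
- by move=> x xI; have [z zJ E] := det_iso_mx f aI xI; exists z.
move=> y yJ; have [z zI E] := det_iso_mx g bJ yJ; exists z => //.
have bn0 : b ^+ n.+1 != 0 by rewrite expf_eq0 (negPf b0).
apply: (mulfI bn0); rewrite mulrCA -E [LHS]mulrA dAB exprMn; ring.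
Qed.

End IdealClasses.

(** * Steinitz' isomorphism *)

Section Steinitz.
Variable R : idomainType.
Hypothesis R_dedekind : dedekind R.
Implicit Types (I J L : submodClosed R^o) (P Q : lmodType R).
Local Notation K := {fraction R}.

(* Replace [J] by an isomorphic [J'] with [I + J' = R]: the sum map [I * J' -> R]
   splits, and its kernel is the intersection of [I] and [J'], i.e. their product. *)
Lemma iso_ideal_prod I J (nzI : nonzero_ideal I) (nzJ : nonzero_ideal J) :
  exists L (nzL : nonzero_ideal L),
    isomorphic (submodule I * submodule J)%type (R^o * submodule L)%type /\
    ideal_class nzL = (ideal_class nzI * ideal_class nzJ)%g.
Proof.
have [|d [b [d0 b0 Cb [i [j [x [iI jJ E ix]]]]]]] :=
  coprime_representative R_dedekind (submod_is_ideal I) (submod_is_ideal J) nzI.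
  exact: nzJ.
(* This is [(b / d) J]; all of it lies in [R] because [b] is in [colon d J]. *)
have [|J' J'P] := @exists_ideal_submod _
    [set x : R | exists2 j : R, j \in J & d * x = b * j].
  split=> [|u v [ju juJ uE] [jv jvJ vE]|c u [ju juJ uE]].
  - by exists 0; rewrite ?mulr0 //; exact: (@rpred0 _ J).
  - exists (ju + jv); first exact: (@rpredD _ J).
    by rewrite mulrDr uE vE mulrDr.
  exists (c * ju); first exact: (@rpredZ _ _ J).
  by rewrite mulrCA uE mulrCA.
have [e eJ e0] := nzJ; have [y yE] := Cb _ eJ.
have y0 : y != 0.
  have : b * e != 0 by exact: mulf_neq0.
  by rewrite yE mulf_eq0 negb_or => /andP[].
have yJ' : y \in J' by apply/J'P; exists e.
have nzJ' : nonzero_ideal J' by exists y.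
have JJ' : ideal_class nzJ = ideal_class nzJ'.
  apply/mem_ideal_class; exists b, d; split=> // u.
    move=> uJ; have [v vE] := Cb _ uJ; exists v => //.
    by apply/J'P; exists u.
  by move=> /J'P[v vJ vE]; exists v.
have [|L LP] := @exists_ideal_submod _ [set u : R | (u \in I) && (u \in J')].
  split=> [|u v /andP[uI uJ] /andP[vI vJ]|c u /andP[uI uJ]]; apply/andP.
  - by split; [exact: (@rpred0 _ I) | exact: (@rpred0 _ J')].
  - by split; [exact: (@rpredD _ I) | exact: (@rpredD _ J')].
  by split; [exact: (@rpredZ _ _ I) | exact: (@rpredZ _ _ J')].
have LE (u : R) : (u \in L) = (u \in I) && (u \in J') by apply/idP/idP => /LP.
have nzL : nonzero_ideal L.
  have [a aI a0] := nzI; exists (a * y); last exact: mulf_neq0.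
  rewrite LE; apply/andP; split; last exact: (@rpredZ _ _ J').
  by rewrite mulrC; exact: (@rpredZ _ _ I).
exists L, nzL; split; last first.
  by rewrite JJ'; apply: (ideal_class_coprime _ _ _ iI _ ix) => //; apply/J'P; exists j.
apply: iso_trans (iso_prod (iso_refl _) (ideal_class_iso JJ')) _.
have sL : linear (fun u : submodule I * submodule J' =>
    (submodule_val u.1 : R^o) + (submodule_val u.2 : R^o)).
  by move=> c u v; rewrite scalerDr addrACA.
have [s sE] : exists s : {linear (submodule I * submodule J')%type -> R^o},
    forall u, s u = (submodule_val u.1 : R^o) + (submodule_val u.2 : R^o).
  by exists (mk_linear sL).
have [|g gE] := projective_kernel (f := s) (@projective_regular R).
  move=> z; exists (z *: (Submodule iI, Submodule ((J'P x).2 (ex_intro2 _ _ j jJ E)))).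
  by rewrite linearZ sE /= ix; exact: mulr1.
apply: iso_trans (iso_trans (ex_intro _ g gE) (iso_prodC _ _)) _.
apply: iso_prod (iso_refl _) _.
have [p pE] : exists p : {linear submodule (kernel s) -> R^o},
    forall u, p u = submodule_val (submodule_val u).1.
  have pL : linear (fun u : submodule I * submodule J' => submodule_val u.1 : R^o).
    by [].
  by exists (GRing.Linear.clone _ _ _ _ (mk_linear pL \o from_submodule (kernel s)) _).
(* The kernel of [s] consists of the pairs [(u, - u)] with [u] in both ideals, so the first
   projection identifies it with [L]. *)
have fL w : p w \in L.
  case: w => [[[u uI] [v vJ]] uv] /=; rewrite LE pE uI /=.
  have E' : u + v = 0 :> R by move: uv; rewrite mem_kernel sE => /eqP.
  have -> : u = -1 * v :> R by rewrite mulN1r; apply/eqP; rewrite -addr_eq0 E'.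
  exact: (@rpredZ _ _ J').
have G1 (u : R) : u \in L -> u \in I by rewrite LE => /andP[].
have G2 (u : R) : u \in L -> - u \in J'.
  by rewrite LE -mulN1r => /andP[_]; exact: (@rpredZ _ _ J').
have G3 (u : R) (uL : u \in L) :
    (Submodule (G1 u uL), Submodule (G2 u uL)) \in kernel s.
  by rewrite mem_kernel sE /= subrr.
exists (to_submodule fL), (fun u => Submodule (G3 _ (submodule_mem u))).
  move=> [[[u uI] [v vJ]] uv]; apply: val_inj.
  have E' : u + v = 0 :> R by move: uv; rewrite mem_kernel sE => /eqP.
  congr pair; apply: val_inj; rewrite /= pE //=.
  by apply/eqP; rewrite eq_sym -addr_eq0 addrC E'.
by move=> [u uL]; apply: val_inj; rewrite /= pE.
Qed.

(* The rank of [P] is [n + 1], not [n]. *)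
Definition rank_class P n c := exists I (nzI : nonzero_ideal I),
  isomorphic P ({ffun 'I_n -> R^o} * submodule I)%type /\ c = ideal_class nzI.

Lemma rank_class_iso P Q n c : isomorphic P Q -> rank_class P n c -> rank_class Q n c.
Proof.
move=> PQ [I [nzI [PI ->]]]; exists I, nzI; split=> //.
exact: iso_trans (iso_sym PQ) PI.
Qed.

Lemma rank_class_ideal n I (nzI : nonzero_ideal I) :
  rank_class ({ffun 'I_n -> R^o} * submodule I)%type n (ideal_class nzI).
Proof. by exists I, nzI; split=> //; exact: iso_refl. Qed.

Lemma rank_class_prod P Q m n c d : rank_class P m c -> rank_class Q n d ->
  rank_class (P * Q)%type (m + n).+1 (c * d)%g.
Proof.
move=> [I [nzI [PI ->]]] [J [nzJ [QJ ->]]].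
have [L [nzL [IJ LE]]] := iso_ideal_prod nzI nzJ.
exists L, nzL; split=> //.
apply: iso_trans (iso_prod PI QJ) _; apply: iso_trans (iso_prodACA _ _ _ _) _.
apply: iso_trans (iso_prod (iso_sym (iso_ffunD _ _ _)) IJ) _.
apply: iso_trans (iso_prodA _ _ _) _; apply: iso_prod (iso_refl _).
exact: iso_trans (iso_prodC _ _) (iso_sym (iso_ffunS _ _)).
Qed.

Lemma rank_class_pow P n c t : rank_class P n c ->
  rank_class {ffun 'I_t.+1 -> P} (t.+1 * n.+1).-1 (c ^+ t.+1)%g.
Proof.
move=> Pc; elim: t => [|t IH].
  rewrite mul1n; apply: rank_class_iso (iso_sym (iso_ffun1 _)) _.
  by rewrite expg1.
apply: rank_class_iso (iso_sym (iso_ffunS _ _)) _.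
rewrite expgS; have -> : (t.+2 * n.+1).-1 = (n + (t.+1 * n.+1).-1).+1.
  rewrite [(t.+2 * _)%N]mulSn; have : (0 < t.+1 * n.+1)%N by [].
  by case: (t.+1 * n.+1)%N => // u _; rewrite addSn addnS.
exact: rank_class_prod.
Qed.

Lemma rank_class_inj P Q n c : rank_class P n c -> rank_class Q n c ->
  isomorphic P Q.
Proof.
move=> [I [nzI [PI cI]]] [J [nzJ [QJ cJ]]].
apply: iso_trans PI (iso_trans _ (iso_sym QJ)); apply: iso_prod (iso_refl _) _.
by apply: (ideal_class_iso (nzI := nzI) (nzJ := nzJ)); rewrite -cI.
Qed.

Lemma rank_class_uniq P n c d : rank_class P n c -> rank_class P n d -> c = d.
Proof.
move=> [I [nzI [PI ->]]] [J [nzJ [PJ ->]]].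
exact: ideal_class_uniq (iso_trans (iso_sym PI) PJ).
Qed.

Lemma rank_class_projective P n c : rank_class P n c -> projective P.
Proof.
move=> [I [nzI [PI _]]]; apply: projective_iso (iso_sym PI) _.
apply: projective_prod; first exact/projective_ffun/projective_regular.
exact: R_dedekind.
Qed.

(** The data from which [rank_eq] computes a rank: over the fraction field the vectors [e i / a] go
    to the unit vectors. *)
Lemma rank_class_coords P n c : rank_class P n c ->
  exists (f : {linear P -> {ffun 'I_n.+1 -> R^o}}) (e : 'I_n.+1 -> P) (a : R),
  [/\ injective f, a != 0 & forall i j, f (e i) j = (i == j)%:R * a].
Proof.
move=> [I [[a aI a0] [/isomorphicP[f [g [fK gK]]] _]]].
exists (GRing.Linear.clone _ _ _ _ (mk_linear (@coords_linear _ n I) \o f) _).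
exists (fun i => g (coord_vec a (Submodule aI) i)), a; split=> // [x y /coords_inj|i j].
  exact: (can_inj fK).
by apply: etrans (coords_vec aI i j); rewrite /= gK.
Qed.

(** [I] times [colon d I] is the principal ideal [dR]. *)
Lemma ideal_class_inv I (nzI : nonzero_ideal I) : exists J (nzJ : nonzero_ideal J),
  (ideal_class nzI * ideal_class nzJ)%g = 1%g.
Proof.
have [d dI d0] := nzI.
have hI := submod_is_ideal I.
have [J JP] := exists_ideal_submod (colon_ideal d [set x : R | x \in I]).
have nzJ : nonzero_ideal J by exists d => //; apply/JP/colon_self.
exists J, nzJ; apply: etrans (Pic_mulE _ _) _.
apply/eqmodP/asboolP; exists 1, d; split; rewrite ?oner_neq0 //.
rewrite tofrac1 (eq_imagel (f := fun x => 1 * x) (f' := id)) ?image_id; last first.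
  by move=> x _; rewrite mul1r.
apply/seteqP; split.
  apply: fideal_prod_sub.
    split=> [|_ _ [_ [u _ <-] <-] [_ [v _ <-] <-]].
      by exists 0; rewrite ?mulr0 //; exists 0; rewrite ?tofrac0.
    by exists (u + v)%:F; [exists (u + v) | rewrite tofracD mulrDr].
  move=> _ _ [u uI <-] [v /JP vJ <-]; have [w wE] := vJ _ uI.
  by exists w%:F; [exists w | rewrite -!tofracM [(u * v)]mulrC wE].
have [m [g [c [gI Cc dE]]]] := ideal_inverse R_dedekind hI dI d0.
move=> _ [_ [u _ <-] <-].
rewrite {1}dE mulrC rmorph_sum mulr_sumr /=.
elim/big_ind: _; [exact: (fideal_prod_closed _ _).1 |
  exact: (fideal_prod_closed _ _).2 |] => i _.
rewrite -tofracM mulrA mulrC tofracM; apply: fideal_prod_mem.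
  by exists (g i) => //; exact: gI.
exists (u * c i) => //; apply/JP; by have [_ _] := colon_ideal d [set x : R | x \in I]; exact.
Qed.

(** Induction on [k]: the first coordinate maps [P] onto an ideal, which is projective, so [P] is
    the sum of this ideal and of a kernel that embeds in [R^(k-1)]. Either summand may vanish. *)
Lemma submodule_free_decomposition k P (f : {linear P -> {ffun 'I_k -> R^o}}) :
  injective f -> (forall x : P, x = 0) \/ exists n c, rank_class P n c.
Proof.
elim: k P f => [|k IH] P f fi.
  by left=> x; apply: fi; rewrite linear0; exact: ffun_ord0.
have L : linear (fun x => f x ord0 : R^o) by move=> a x y; rewrite linearP !ffunE.
have [p pE] : exists p : {linear P -> R^o}, forall x, p x = f x ord0.
  by exists (mk_linear L).
have Lq : linear (fun x : submodule (kernel p) =>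
    [ffun i => f (submodule_val x) (lift ord0 i)] : {ffun 'I_k -> R^o}).
  by move=> a x y; apply/ffunP => i; rewrite !ffunE linearP !ffunE.
have qi : injective (mk_linear Lq).
  move=> [x xp] [y yp] /= /ffunP E; apply/val_inj/fi/ffunP => i /=.
  case: (unliftP ord0 i) => [j ->|->]; first by have := E j; rewrite !ffunE.
  by move: xp yp; rewrite !mem_kernel !pE /= => /eqP -> /eqP ->.
pose q := to_submodule (@mem_lin_range _ _ _ p).
have qs y : exists x, q x = y.
  case: y => y yI; have [x xE] := lin_rangeP yI.
  by exists x; apply: val_inj.
have kq : isomorphic P (submodule (kernel q) * submodule (lin_range p))%type.
  exact: projective_kernel (@R_dedekind _) qs.
have kE : isomorphic (submodule (kernel q)) (submodule (kernel p)).
  by apply: iso_submodule_eq => x; rewrite !mem_kernel -(inj_eq val_inj).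
have {kq kE}Pkq := iso_trans kq (iso_prod kE (iso_refl _)).
case: (pselect (nonzero_ideal (lin_range p))) => [nzp|zp]; last first.
  have I0 (y : submodule (lin_range p)) : y = 0.
    case: y => y yI; apply: val_inj => /=; apply: contrapT => /eqP y0; apply: zp.
    by exists y.
  have {Pkq}Pk := iso_trans Pkq (iso_prod0r _ I0).
  case: (IH _ _ qi) => [k0|[n [c kc]]]; [left=> x|right].
    have [g [h hK _]] := Pk; by rewrite -[x]hK (k0 (g x)) -(k0 (g 0)) hK.
  by exists n, c; exact: rank_class_iso (iso_sym Pk) kc.
right; have Ic : rank_class (submodule (lin_range p)) 0 (ideal_class nzp).
  apply: rank_class_iso (rank_class_ideal 0 nzp).
  exact/iso_prod0l/ffun_ord0.
case: (IH _ _ qi) => [k0|[n [c kc]]].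
  exists 0%N, (ideal_class nzp); apply: rank_class_iso Ic.
  exact: iso_trans (iso_sym (iso_prod0l _ k0)) (iso_sym Pkq).
exists (n + 0).+1, (c * ideal_class nzp)%g.
exact: rank_class_iso (iso_sym Pkq) (rank_class_prod kc Ic).
Qed.

End Steinitz.

(** * Rank and the torsion-free quotient *)

Lemma has_dimension_uniq (K : fieldType) (V : lmodType K) m n :
  has_dimension V m -> has_dimension V n -> m = n.
Proof.
suff h p q : has_dimension V p -> has_dimension V q -> (p <= q)%N.
  by move=> Vm Vn; apply/eqP; rewrite eqn_leq !h.
move=> [e eP] [e' e'P].
have [A AE] : exists A : 'I_p -> {ffun 'I_q -> K}, forall i, e i = \sum_j A i j *: e' j.
  exists (fun i => sval (cid (e'P (e i)))) => i; case: cid => c [] //.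
have [B BE] : exists B : 'I_q -> {ffun 'I_p -> K}, forall i, e' i = \sum_j B i j *: e j.
  exists (fun i => sval (cid (eP (e' i)))) => i; case: cid => c [] //.
apply: (@mulmx1_min K _ _ (\matrix_(i, j) A i j) (\matrix_(i, j) B i j)).
apply/matrixP => i k; rewrite !mxE.
have [c [_ cP]] := eP (e i).
transitivity (c k).
  suff -> : c = [ffun k => \sum_j A i j * B j k].
    by rewrite ffunE; apply: eq_bigr => j _; rewrite !mxE.
  apply: cP; rewrite {1}AE.
  under [RHS]eq_bigr do rewrite ffunE scaler_suml.
  rewrite [RHS]exchange_big; apply: eq_bigr => j _ /=.
  by rewrite BE scaler_sumr; apply: eq_bigr => l _; rewrite scalerA.
suff -> : c = [ffun k => (i == k)%:R] by rewrite ffunE.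
apply: cP; rewrite (bigD1 i) //= big1 => [|j ij].
  by rewrite addr0 ffunE eqxx scale1r.
by rewrite ffunE eq_sym (negPf ij) scale0r.
Qed.

Section Tensors.
Variables (R : idomainType) (M : lmodType R).
Local Notation K := {fraction R}.
Local Notation MK := (base_change (@FracField.tofrac R) M).

Definition tensor (x : M) (k : K) : MK := tensors _ [:: (x, k)].

Lemma tensor_balanced : balanced (@FracField.tofrac R) tensor.
Proof.
split=> [k x y|x k l|r x k].
- rewrite [RHS]base_change_addE; apply/tensorsP => V b [b1 b2 b3].
  by rewrite /balanced_sum !big_cons !big_nil /= !addr0 b1.
- rewrite [RHS]base_change_addE; apply/tensorsP => V b [b1 b2 b3].
  by rewrite /balanced_sum !big_cons !big_nil /= !addr0 b2.
apply/tensorsP => V b [b1 b2 b3].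
by rewrite /balanced_sum !big_cons !big_nil /= !addr0 b3.
Qed.

Lemma tensorZ k x l : k *: tensor x l = tensor x (k * l).
Proof. exact: base_change_scaleE. Qed.

Lemma tensor_sum m (x : 'I_m -> M) k : tensor (\sum_i x i) k = \sum_i tensor (x i) k.
Proof.
have [b1 _ _] := tensor_balanced.
apply: (big_morph (tensor^~ k)) => [u v|]; first exact: b1.
by apply: (addrI (tensor 0 k)); rewrite -b1 !addr0.
Qed.

Lemma tensor_ind (P : MK -> Prop) : P 0 -> (forall z w, P z -> P w -> P (z + w)) ->
  (forall x k, P (tensor x k)) -> forall z, P z.
Proof.
move=> P0 PD Pt; apply: tensorsW => s; elim: s => [|[x k] s IH]; first exact: P0.
by rewrite -[_ :: s]cat1s -base_change_addE; exact: PD (Pt x k) IH.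
Qed.

Section Functional.
Variable f : {linear M -> R^o}.

(** The extension of the form [f] to the tensor product; such extensions of coordinate forms prove
    linear independence in [rank_eq]. *)
Definition functional_map (x : M) (k : K) : K := (f x : R)%:F * k.

Lemma functional_balanced : balanced (@FracField.tofrac R) functional_map.
Proof.
split=> [k x y|x k l|r x k]; rewrite /functional_map.
- by rewrite linearD tofracD mulrDl.
- exact: mulrDr.
have -> : (f (r *: x) : R) = r * (f x : R) by exact: (lin_scale f r x).
by rewrite tofracM mulrCA mulrA.
Qed.

Definition functional (z : MK) : K := balanced_sum functional_map (repr z).

Lemma functionalE s : functional (tensors _ s) = balanced_sum functional_map s.
Proof. exact: balanced_sum_repr functional_balanced. Qed.

Lemma functional_tensor x k : functional (tensor x k) = (f x : R)%:F * k.
Proof. by rewrite functionalE /balanced_sum big_seq1. Qed.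

Lemma functionalD z w : functional (z + w) = functional z + functional w.
Proof.
elim/tensorsW: z => s; elim/tensorsW: w => t.
by rewrite [_ + _ in LHS]base_change_addE !functionalE balanced_cat.
Qed.

Lemma functionalZ k z : functional (k *: z) = k * functional z.
Proof.
elim/tensorsW: z => s; rewrite [_ *: _]base_change_scaleE !functionalE.
rewrite balanced_scale /balanced_sum mulr_sumr; apply: eq_bigr => p _.
by rewrite /scale_map /functional_map mulrCA.
Qed.

Lemma functional_sum m (c : 'I_m -> K) z :
  functional (\sum_i c i *: z i) = \sum_i c i * functional (z i).
Proof.
have F0 : functional 0 = 0 by rewrite -(scale0r 0) functionalZ mul0r.
rewrite (big_morph functional functionalD F0).
by apply: eq_bigr => i _; rewrite functionalZ.
Qed.

End Functional.

(** The tensors of the [e i] with [1] form a basis. They span because [f] kills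
    [a x - sum f(x)_i e_i], which is therefore torsion; they are independent because the coordinates
    of [f] take the value [a] or [0] on them. *)
Lemma rank_eq n (f : {linear M -> {ffun 'I_n -> R^o}}) (e : 'I_n -> M) (a : R) :
  (forall x, f x = 0 -> torsion_pred x) -> a != 0 ->
  (forall i j, f (e i) j = (i == j)%:R * a) -> rank M = n.
Proof.
move=> ftor a0 fe.
have L i : linear (fun x => f x i : R^o) by move=> c x y; rewrite linearP !ffunE.
have aF : a%:F != 0 :> K by rewrite tofrac_eq0.
have dimM : has_dimension MK n.
  exists (fun i => tensor (e i) 1) => v.
  have [c cE] : exists c : {ffun 'I_n -> K}, v = \sum_i c i *: tensor (e i) 1.
    elim/tensor_ind: v => [|z w [c ->] [d ->]|x k].
    - by exists 0; rewrite big1 // => i _; rewrite ffunE scale0r.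
    - exists (c + d); rewrite -big_split; apply: eq_bigr => i _ /=.
      by rewrite ffunE scalerDl.
    have : torsion_pred (a *: x - \sum_i (f x i : R) *: e i).
      apply: ftor; apply/ffunP => j; rewrite linearB linearZ linear_sum !ffunE sum_ffunE.
      apply/eqP; rewrite subr_eq0; apply/eqP.
      rewrite (bigD1 j) //= big1 ?addr0 => [|i ij].
        by rewrite linearZ ffunE fe eqxx mul1r; exact: mulrC.
      by rewrite linearZ ffunE fe (negPf ij) mul0r; exact: mulr0.
    move=> /asboolP[b b0]; rewrite scalerBr => /eqP; rewrite subr_eq0 => /eqP bE.
    have bF : (b * a)%:F != 0 :> K by rewrite tofrac_eq0 mulf_neq0.
    (* Moving [b * a] across the tensor sign replaces [x] by [b a x], which equals
       [sum b f(x)_i e_i]. *)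
    exists [ffun i => (b * f x i : R)%:F * (k / (b * a)%:F)].
    have [_ _ t3] := tensor_balanced.
    have -> : tensor x k = tensor ((b * a) *: x) (k / (b * a)%:F).
      by rewrite t3 mulrCA divff // mulr1.
    rewrite -scalerA bE scaler_sumr tensor_sum; apply: eq_bigr => i _.
    by rewrite scalerA t3 tensorZ mulr1 ffunE.
  exists c; split=> // d dE; apply/ffunP => j.
  have h (b : {ffun 'I_n -> K}) :
      functional (mk_linear (L j)) (\sum_i b i *: tensor (e i) 1) = b j * a%:F.
    rewrite functional_sum (bigD1 j) //= big1 ?addr0 => [|i ij].
      by rewrite functional_tensor /= fe eqxx mul1r mulr1.
    by rewrite functional_tensor /= fe (negPf ij) mul0r tofrac0 mul0r mulr0.
  by apply: (mulIf aF); rewrite -!h -cE -dE.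
rewrite /rank; case: xgetP => [m _ /has_dimension_uniq-/(_ _ dimM)//|/(_ n)/(_ dimM)//].
Qed.

End Tensors.

Section Structure.
Variable R : idomainType.
Implicit Types M N P : lmodType R.

Lemma torsionP M x : x \in torsion_submodClosed M <-> exists2 a : R, a != 0 & a *: x = 0.
Proof. by split=> /asboolP. Qed.

Lemma torsion_free_ffun n (a : R) (v : {ffun 'I_n -> R^o}) :
  a != 0 -> a *: v = 0 -> v = 0.
Proof.
move=> a0 /ffunP av; apply/ffunP => i; have := av i; rewrite !ffunE => /eqP.
by rewrite mulf_eq0 (negPf a0) => /eqP.
Qed.

(** For a maximal independent subfamily, each [g j] has a nonzero multiple in its span; [a] is the
    product of these multipliers. *)
Lemma maximal_free_family M k (g : 'I_k -> M) : exists (S : {set 'I_k}) (a : R),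
  [/\ a != 0,
    forall c : 'I_k -> R, \sum_(i in S) c i *: g i = 0 -> forall i, i \in S -> c i = 0 &
    forall j, exists c : 'I_k -> R, a *: g j = \sum_(i in S) c i *: g i].
Proof.
pose free (S : {set 'I_k}) := `[< forall c : 'I_k -> R,
  \sum_(i in S) c i *: g i = 0 -> forall i, i \in S -> c i = 0 >].
have [|S /maxsetP[/asboolP Sfree Smax]] := @ex_maxset _ free.
  by exists finset.set0; apply/asboolP => c _ i; rewrite inE.
have dep j : exists b : R, b != 0 /\
    exists c : 'I_k -> R, b *: g j = \sum_(i in S) c i *: g i.
  have [jS|jS] := boolP (j \in S).
    exists 1; split; first exact: oner_neq0.
    exists (fun i => (i == j)%:R); rewrite (bigD1 j) //= big1 ?eqxx ?addr0 //.
    by move=> i /andP[_ /negPf ->]; rewrite scale0r.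
  have : ~~ free (j |: S).
    apply/negP => /Smax/(_ (finset.subsetUr _ _)) jSS.
    by move: jS; rewrite -jSS finset.setU11.
  move=> /asboolPn/existsNP[c /not_implyP[cE /existsNP[i /not_implyP[iS ci]]]].
  rewrite big_setU1 //= in cE.
  exists (c j); split; last first.
    exists (fun i => - c i); apply/eqP; rewrite -subr_eq0 -sumrN -[X in _ == X]cE.
    apply/eqP; congr (_ + _); apply: eq_bigr => l _; by rewrite scaleNr opprK.
  apply/eqP => cj; move: cE; rewrite cj scale0r add0r => /Sfree cS; apply: ci.
  by move: iS; rewrite finset.in_setU1 => /orP[/eqP ->|/cS].
have [b bP] := choice dep.
exists S, (\prod_j b j); split=> //.
  by apply/prodf_neq0 => j _; have [] := bP j.
move=> j; have [_ [c cE]] := bP j; exists (fun i => (\prod_(l | l != j) b l) * c i).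
rewrite (bigD1 j) //= mulrC -scalerA cE scaler_sumr.
by apply: eq_bigr => i _; rewrite scalerA.
Qed.

(** [f x] lists the coefficients of [a x] in a maximal independent subfamily, with zeros at the
    other indices. Independence makes [f] linear, and [f x = 0] means [a x = 0]. *)
Lemma torsion_free_embedding M : finitely_generated M ->
  exists k (f : {linear M -> {ffun 'I_k -> R^o}}),
    forall x, (x \in torsion_submodClosed M) = (f x == 0).
Proof.
move=> [k [g gP]]; have [S [a [a0 Sfree Sdep]]] := maximal_free_family g.
have Suniq (c d : 'I_k -> R) : \sum_(i in S) c i *: g i = \sum_(i in S) d i *: g i ->
    forall i, i \in S -> c i = d i.
  move=> /eqP; rewrite -subr_eq0 -sumrB => /eqP E i iS.
  apply/eqP; rewrite -subr_eq0; apply/eqP.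
  apply: (Sfree (fun i => c i - d i)) => //; rewrite -[RHS]E.
  by apply: eq_bigr => l _; rewrite scalerBl.
have dep x : exists c : 'I_k -> R, a *: x = \sum_(i in S) c i *: g i.
  have [d dE] := gP x; have [c cE] := choice Sdep.
  exists (fun i => \sum_j d j * c j i); rewrite dE scaler_sumr.
  under [RHS]eq_bigr do rewrite scaler_suml.
  rewrite [RHS]exchange_big; apply: eq_bigr => j _ /=.
  rewrite scalerA mulrC -scalerA cE scaler_sumr.
  by apply: eq_bigr => i _; rewrite scalerA.
have [c cE] := choice dep.
pose f x : {ffun 'I_k -> R^o} := [ffun i => if i \in S then c x i else 0].
have L : linear f.
  move=> b x y; apply/ffunP => i; rewrite !ffunE; case: ifPn => iS; last first.
    by rewrite scaler0 addr0.
  apply: (Suniq _ (fun i => b * c x i + c y i)) iS; rewrite -cE scalerDr scalerA.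
  rewrite mulrC -scalerA !cE scaler_sumr -big_split; apply: eq_bigr => j _ /=.
  by rewrite scalerDl scalerA.
exists k, (mk_linear L) => x; apply/idP/eqP => [/torsionP[b b0 bx]|/= /ffunP fx].
  by apply: (torsion_free_ffun b0); rewrite -lin_scale bx linear0.
apply/torsionP; exists a => //; rewrite cE big1 // => i iS.
by have := fx i; rewrite !ffunE iS => ->; rewrite scale0r.
Qed.

Lemma mod_torsion_embedding M : finitely_generated M ->
  exists k (f : {linear mod_torsion M -> {ffun 'I_k -> R^o}}), injective f.
Proof.
move=> /torsion_free_embedding[k [f fE]].
pose q := to_submodule (@mem_lin_range _ _ _ f).
have [||h [h' hK h'K]] := @first_iso _ _ _ q _ (torsion_submodClosed M).
- by move=> [y yI]; have [x xE] := lin_rangeP yI; exists x; apply: val_inj.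
- by move=> x; rewrite fE -(inj_eq val_inj).
exists k, (GRing.Linear.clone _ _ _ _ (from_submodule (lin_range f) \o h) _).
exact: inj_comp val_inj (can_inj hK).
Qed.

Hypothesis R_dedekind : dedekind R.

Lemma rank_class_rank M n c : rank_class (mod_torsion M) n c -> rank M = n.+1.
Proof.
move=> /rank_class_coords[f [e [a [fi a0 fe]]]].
have [e' eE] := choice (fun i => quot_proj_surj (S := torsion_submodClosed M) (e i)).
apply: (@rank_eq _ _ _ (GRing.Linear.clone _ _ _ _
  (f \o quot_proj (torsion_submodClosed M)) _) e' a) => // [x /= fx|i j /=].
  suff : x \in torsion_submodClosed M by [].
  by rewrite -quot_proj_eq0; apply/eqP/fi; rewrite linear0.
exact: etrans (congr1 (fun y => f y j) (eE i)) (fe i j).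
Qed.

Lemma rank_torsion M : (forall x : mod_torsion M, x = 0) -> rank M = 0%N.
Proof.
move=> M0.
pose z : {linear M -> {ffun 'I_0 -> R^o}} := \0.
apply: (rank_eq (f := z) (e := fun=> 0) (a := 1)) => [x _||[]//].
  suff : x \in torsion_submodClosed M by [].
  by rewrite -quot_proj_eq0; apply/eqP/M0.
exact: oner_neq0.
Qed.

(** The set from which [steinitz_class] chooses contains [c] and, by [rank_class_uniq], nothing
    else, so the default value is not taken. *)
Lemma rank_class_steinitz M n c : rank_class (mod_torsion M) n c ->
  steinitz_class M = c.
Proof.
move=> Mc; have rE := rank_class_rank Mc.
rewrite /steinitz_class rE; case: xgetP => [d _ Md|/(_ c)[]//].
exact: rank_class_uniq Md Mc.
Qed.

Lemma mod_torsion_rank_class M : finitely_generated M ->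
  (forall x : mod_torsion M, x = 0) \/ exists n c, rank_class (mod_torsion M) n c.
Proof.
move=> /mod_torsion_embedding[k [f fi]].
exact: submodule_free_decomposition R_dedekind _ _ _ fi.
Qed.

Lemma torsion_decomposition M : finitely_generated M ->
  isomorphic M (torsion M * mod_torsion M)%type.
Proof.
move=> Mfg.
have pM : projective (mod_torsion M).
  case: (mod_torsion_rank_class Mfg) => [M0|[n [c Mc]]].
    exact: projective_zero.
  exact: rank_class_projective R_dedekind _ _ _ Mc.
have qs := @quot_proj_surj _ _ (torsion_submodClosed M).
apply: iso_trans (projective_kernel pM qs) (iso_prod _ (iso_refl _)).
by apply: iso_submodule_eq => x; rewrite mem_kernel quot_proj_eq0.
Qed.

End Structure.

(** * Localization *)

(** When [g] generates [M], this is a finite presentation of [M], which is what allows maps between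
    localizations to be lifted. *)
Definition finitely_related (R : pzRingType) (M : lmodType R) k (g : 'I_k -> M) :=
  exists m (r : 'I_m -> 'I_k -> R), (forall l, \sum_i r l i *: g i = 0) /\
    forall c : 'I_k -> R, \sum_i c i *: g i = 0 ->
      exists d : 'I_m -> R, forall i, c i = \sum_l d l * r l i.

Section FiniteRelations.
Variable R : idomainType.
Hypothesis R_dedekind : dedekind R.

Lemma fg_submodule_ffun k (S : submodClosed {ffun 'I_k -> R^o}) :
  finitely_generated (submodule S).
Proof.
have fi : injective (from_submodule S) by exact: val_inj.
case: (submodule_free_decomposition R_dedekind fi) => [z|[n [c [I [nzI [SI _]]]]]].
  exact: fg_zero.
apply: fg_iso (iso_sym SI) _; apply: fg_prod; first exact/fg_ffun/fg_regular.
have [n' [g [gI gP]]] := dedekind_noetherian R_dedekind (submod_is_ideal I).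
exists n', (fun i => Submodule (gI i)) => -[x xI].
have [d dE] := gP x xI; exists d; apply: val_inj.
by rewrite -[RHS]/(from_submodule I _) linear_sum /= dE.
Qed.

Lemma finite_relations (M : lmodType R) k (g : 'I_k -> M) : finitely_related g.
Proof.
have L : linear (fun c : {ffun 'I_k -> R^o} => \sum_i (c i : R) *: g i).
  move=> a c d; rewrite scaler_sumr -big_split; apply: eq_bigr => i _ /=.
  by rewrite !ffunE scalerDl scalerA.
have [p pE] : exists p : {linear {ffun 'I_k -> R^o} -> M},
    forall c, p c = \sum_i (c i : R) *: g i by exists (mk_linear L).
have [m [r rP]] := fg_submodule_ffun (kernel p).
exists m, (fun l i => submodule_val (r l) i : R); split=> [l|c cE].
  by apply/eqP; rewrite -pE -mem_kernel; exact: submodule_mem.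
have ck : [ffun i => c i : R^o] \in kernel p.
  by rewrite mem_kernel pE; under eq_bigr do rewrite ffunE; apply/eqP.
have [d dE] := rP (Submodule ck); exists d => i.
have := congr1 (fun v => from_submodule (kernel p) v i) dE.
by rewrite linear_sum sum_ffunE /= ffunE => ->; apply: eq_bigr => l _; rewrite !ffunE.
Qed.

End FiniteRelations.

Section Localize.
Variables (R : comNzRingType) (S : mulrClosed R).
Local Notation D := (denominator S).
Local Notation one := (denominator1 S).
Implicit Types M N : lmodType R.

Lemma locfrac_eq M (x y : M) (s t : D) : den t *: x = den s *: y ->
  locfrac x s = locfrac y t.
Proof. by move=> E; apply/locfracP; exists one; rewrite !mul1r. Qed.

Lemma locfracDs M (x y : M) (s : D) : locfrac x s + locfrac y s = locfrac (x + y) s.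
Proof.
rewrite locfracD; apply: locfrac_eq => /=.
by rewrite -scalerDr scalerA.
Qed.

Lemma locfrac0 M (s : D) : locfrac (0 : M) s = 0.
Proof. by apply: locfrac_eq; rewrite !scaler0. Qed.

Lemma locfracZ M (r : R) (x : M) (s t : D) :
  (locfrac (r : R^o) s : locring S) *: (locfrac x t : locmod S M) =
  locfrac (r *: x) (denominatorM s t).
Proof. exact: loc_actE. Qed.

Lemma locfrac_sum M k (c : 'I_k -> R) (x : 'I_k -> M) (s : D) :
  locfrac (\sum_i c i *: x i) s =
  \sum_i (locfrac (c i : R^o) one : locring S) *: (locfrac (x i) s : locmod S M).
Proof.
rewrite (big_morph (fun y : M => locfrac y s) (id1 := 0) (op1 := +%R)).
- apply: eq_bigr => i _; rewrite locfracZ; congr locfrac.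
  by apply: val_inj; rewrite /= mul1r.
- by move=> x1 y1; rewrite locfracDs.
exact: locfrac0.
Qed.

Section Map.
Variables (M N : lmodType R) (f : {linear M -> N}).

Definition loc_map (z : locmod S M) : locmod S N :=
  locfrac (f (repr z).1) (repr z).2.

Lemma loc_mapE x s : loc_map (locfrac x s) = locfrac (f x) s.
Proof.
have [u uE] := locfrac_repr x s; apply/locfracP; exists u.
by rewrite -!lin_scale uE.
Qed.

Fact loc_map_linear : linear (loc_map : locmod S M -> locmod S N).
Proof.
move=> a z w; elim/locfracW: z => x s; elim/locfracW: w => y t.
elim/locfracW: a => a r.
transitivity (loc_map (@locfrac R S M ((a : R) *: x) (denominatorM r s) + locfrac y t)).
  by congr (loc_map (_ + _)); exact: locfracZ.
transitivity (@locfrac R S N ((a : R) *: f x) (denominatorM r s) + locfrac (f y) t).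
  rewrite locfracD loc_mapE locfracD; congr locfrac.
  by rewrite linearD !(lin_scale f).
rewrite !loc_mapE; congr (_ + _); exact/esym/locfracZ.
Qed.

End Map.

Lemma splits_localize t M N : splits t M N -> splits t (locmod S M) (locmod S N).
Proof.
move=> [f [g fg]]; exists (fun k => mk_linear (loc_map_linear (f k))).
exists (fun l => mk_linear (loc_map_linear (g l))) => k l; apply: locfracW => x s /=.
rewrite !loc_mapE fg; case: eqP => _; first by rewrite !scale1r.
by rewrite !scale0r locfrac0.
Qed.

Lemma common_denominator M k (z : 'I_k -> locmod S M) :
  exists s (x : 'I_k -> M), forall i, z i = locfrac (x i) s.
Proof.
have /choice[xs xsE] : forall i, exists p : M * D, z i = locfrac p.1 p.2.
  by move=> i; elim/locfracW: (z i) => x s; exists (x, s).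
have sS : \prod_i den (xs i).2 \in S.
  by apply: rpred_prod => i _; exact: den_mem.
exists (Denominator sS), (fun i => (\prod_(j | j != i) den (xs j).2) *: (xs i).1) => i.
by rewrite xsE; apply: locfrac_eq; rewrite /= scalerA (bigD1 i).
Qed.

Lemma common_annihilator k M (x : 'I_k -> M) : (forall i, exists u : D, den u *: x i = 0) ->
  exists u : D, forall i, den u *: x i = 0.
Proof.
move=> /choice[u uE].
have sS : \prod_i den (u i) \in S by apply: rpred_prod => i _; exact: den_mem.
exists (Denominator sS) => i /=.
by rewrite (bigD1 i) //= mulrC -scalerA uE scaler0.
Qed.

Lemma locfrac_eq0 M (x : M) (s : D) :
  locfrac x s = 0 -> exists u : D, den u *: x = 0.
Proof.
by move=> /locfracP[u uE]; exists u; move: uE; rewrite scaler0 /= mulr1.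
Qed.

(** With a common denominator [s], the images of the generators are [n i / s]. The relations hold
    among the [n i] only after localization, but one [u] in [S] annihilates the finitely many
    defects, so [g i] can be sent to [u n i]. *)
Lemma lift_linear M N k (g : 'I_k -> M)
    (gP : forall v, exists c : 'I_k -> R, v = \sum_i c i *: g i)
    (gr : finitely_related g) (phi : {linear locmod S M -> locmod S N}) :
  exists (f : {linear M -> N}) (s : D), forall x, phi (locfrac x one) = locfrac (f x) s.
Proof.
have [s [n nE]] := common_denominator (fun i => phi (locfrac (g i) one)).
have phiE (c : 'I_k -> R) : phi (locfrac (\sum_i c i *: g i) one) =
    locfrac (\sum_i c i *: n i) s.
  rewrite !locfrac_sum linear_sum; apply: eq_bigr => i _.
  by rewrite linearZ nE.
have [m [r [rg rP]]] := gr.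
have [|u uE] := @common_annihilator m N (fun l => \sum_i r l i *: n i).
  by move=> l; apply: (@locfrac_eq0 _ _ s); rewrite -phiE rg locfrac0 linear0.
have [|f fE] := linear_of_generators (h := fun i => den u *: n i) gP.
  move=> c /rP[d dE].
  under eq_bigr do rewrite dE scaler_suml.
  rewrite exchange_big big1 // => l _ /=.
  transitivity (d l *: (den u *: \sum_i r l i *: n i)); last by rewrite uE scaler0.
  rewrite !scaler_sumr; apply: eq_bigr => i _; rewrite !scalerA.
  by congr (_ *: _); ring.
exists f, (denominatorM u s) => x; have [c ->] := gP x.
rewrite phiE linear_sum; apply: locfrac_eq; rewrite /= !scaler_sumr.
apply: eq_bigr => i _; rewrite (lin_scale f) fE !scalerA; congr (_ *: _); ring.
Qed.

Lemma lift_linear_family t M N k (g : 'I_k -> M)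
    (gP : forall v, exists c : 'I_k -> R, v = \sum_i c i *: g i)
    (gr : finitely_related g) (phi : 'I_t -> {linear locmod S M -> locmod S N}) :
  exists (f : 'I_t -> {linear M -> N}) (s : D),
    forall i x, phi i (locfrac x one) = locfrac (f i x) s.
Proof.
have /choice[fs fsE] : forall i, exists p : {linear M -> N} * D,
    forall x, phi i (locfrac x one) = locfrac (p.1 x) p.2.
  by move=> i; have [f [s E]] := lift_linear gP gr (phi i); exists (f, s).
have sS : \prod_i den (fs i).2 \in S.
  by apply: rpred_prod => i _; exact: den_mem.
exists (fun i => GRing.Linear.clone _ _ _ _
  ((\prod_(j | j != i) den (fs j).2) \*: (fs i).1) _).
exists (Denominator sS) => i x; rewrite fsE; apply: locfrac_eq => /=.
by rewrite scalerA (bigD1 i).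
Qed.

Lemma splits_lift t M N : finitely_generated M -> finitely_generated N ->
  (forall P : lmodType R, finitely_generated P -> forall k (g : 'I_k -> P),
    finitely_related g) ->
  splits t (locmod S M) (locmod S N) ->
  exists (f : 'I_t -> {linear M -> N}) (g : 'I_t -> {linear N -> M}) (s : D),
    forall k l x, f k (g l x) = ((k == l)%:R * den s) *: x.
Proof.
move=> [m [h hP]] [n [h' h'P]] rel [phi [psi phipsi]].
have [f [s fE]] := lift_linear_family hP (rel M (ex_intro _ m (ex_intro _ h hP)) _ h) phi.
have [g [s' gE]] := lift_linear_family h'P (rel N (ex_intro _ n (ex_intro _ h' h'P)) _ h') psi.
have phiE k y : phi k (locfrac y s') = locfrac (f k y) (denominatorM s' s).
  pose r : locring S := locfrac (1 : R^o) s'.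
  have -> : locfrac y s' = r *: (locfrac y one : locmod S M).
    apply: etrans _ (esym (locfracZ _ _ _ _)); rewrite scale1r; congr locfrac.
    by apply: val_inj; rewrite /= mulr1.
  apply: etrans (lin_scale (phi k) _ _) _; rewrite fE.
  by apply: etrans (locfracZ _ _ _ _) _; rewrite scale1r.
(* [f k (g l x)] and the scalar multiple of [x] agree in the localization; one [u] makes them agree
   for all pairs of indices and all generators of [N], hence everywhere. *)
pose I := ('I_t * 'I_t * 'I_n)%type.
pose d (i : I) := f i.1.1 (g i.1.2 (h' i.2)) -
  ((i.1.1 == i.1.2)%:R * (den s * den s')) *: h' i.2.
have [|u uE] := @common_annihilator #|{: I}| N (fun i => d (enum_val i)).
  move=> i; move: (enum_val i) => [[k l] j]; rewrite /d /=.
  have E : locfrac (f k (g l (h' j))) (denominatorM s' s) =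
      locfrac ((k == l)%:R *: h' j) one.
    rewrite -phiE -gE phipsi; case: eqP => _; first by rewrite !scale1r.
    by rewrite !scale0r locfrac0.
  have [u] := (locfracP _ _ _ _).1 E; rewrite /= mulr1 => uE.
  exists u; rewrite scalerBr uE !scalerA; apply/eqP; rewrite subr_eq0; apply/eqP.
  by congr (_ *: _); ring.
have {}uE k l j : den u *: f k (g l (h' j)) =
    ((k == l)%:R * (den u * (den s * den s'))) *: h' j.
  have := uE (enum_rank (k, l, j)); rewrite enum_rankK /d /= scalerBr => /eqP.
  rewrite subr_eq0 => /eqP ->; rewrite scalerA; congr (_ *: _); ring.
exists (fun k => GRing.Linear.clone _ _ _ _ (den u \*: f k) _), g.
exists (denominatorM u (denominatorM s s')) => k l x /=.
have [c ->] := h'P x; rewrite (linear_sum (g l)) (linear_sum (f k)) !scaler_sumr.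
apply: eq_bigr => j _; rewrite (lin_scale (g l)) (lin_scale (f k)).
rewrite [LHS]scalerA [den u * _]mulrC -[LHS]scalerA uE !scalerA; congr (_ *: _).
exact: mulrC.
Qed.

End Localize.

(** * Torsion modules *)

Section Annihilators.
Variable R : idomainType.
Hypothesis R_dedekind : dedekind R.
Implicit Types M N P Q : lmodType R.

Definition annihilator Q : set R := [set a | forall x : Q, a *: x = 0].

Lemma annihilator_ideal Q : is_ideal (annihilator Q).
Proof.
split=> [x|a b ha hb x|a b hb x]; first exact: scale0r.
  by rewrite scalerDl ha hb addr0.
by rewrite -scalerA hb scaler0.
Qed.

Lemma torsion_annihilator N : finitely_generated (torsion N) ->
  exists2 d, annihilator (torsion N) d & d != 0.
Proof.
move=> [n [g gP]].
have /choice[b bP] : forall i, exists b : R, b != 0 /\ b *: g i = 0.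
  move=> i; have /torsionP[b b0 bg] := submodule_mem (g i).
  by exists b; split=> //; apply: val_inj.
exists (\prod_i b i); last by apply/prodf_neq0 => i _; have [] := bP i.
move=> x; have [c ->] := gP x; rewrite scaler_sumr big1 // => i _.
have [_ bg] := bP i.
by rewrite scalerA mulrC (bigD1 i) //= mulrCA mulrC -scalerA bg scaler0.
Qed.

Lemma splits_glue t P Q d : annihilator Q d -> d != 0 ->
  (forall m, maximal_ideal m -> annihilator Q `<=` m -> exists
    (f : 'I_t -> {linear P -> Q}) (g : 'I_t -> {linear Q -> P}) (s : R),
    ~ m s /\ forall k l x, f k (g l x) = ((k == l)%:R * s) *: x) ->
  splits t P Q.
Proof.
move=> Id d0 loc; have hI := annihilator_ideal Q.
pose G : set R := [set e | exists (f : 'I_t -> {linear P -> Q})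
  (g : 'I_t -> {linear Q -> P}), forall k l x,
  f k (g l x) = ((k == l)%:R * e) *: x].
have annE (a b : R) (x : Q) : annihilator Q (a - b) -> a *: x = b *: x.
  by move=> /(_ x)/eqP; rewrite scalerBl subr_eq0 => /eqP.
have [_ ID IM] := hI.
have [|e e'|m mm Im|u [[f [g fg]] u1]] := semilocal_glue R_dedekind (G := G) hI Id d0.
- by exists (fun=> \0), (fun=> \0) => k l x; rewrite mulr0 scale0r.
- move=> [f [g fg]] [f' [g' fg']] I1 I2.
  (* Both families get the weights [e] and [(1 - e) * e']. Mixed terms contain [e * (1 - e)], which
     kills [Q]; the remaining [e^3 + (1 - e)^2 e'^3] is congruent to [e + (1 - e) * e']. *)
  exists (fun k => GRing.Linear.clone _ _ _ _
    ((e \*: f k) \+ (((1 - e) * e') \*: f' k)) _).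
  exists (fun k => GRing.Linear.clone _ _ _ _
    ((e \*: g k) \+ (((1 - e) * e') \*: g' k)) _).
  move=> k l x /=; rewrite !(linearD (f k)) !(linearD (f' k)).
  rewrite !(lin_scale (f k)) !(lin_scale (f' k)).
  rewrite !fg !fg' !scalerDr !scalerA.
  have z (c : R) (y : Q) : (c * (e * (1 - e))) *: y = 0.
    rewrite -[RHS](scale0r y); apply: annE; rewrite subr0.
    have -> : c * (e * (1 - e)) = (- c) * (e ^+ 2 - e) by ring.
    exact: IM.
  have -> : e * ((1 - e) * e') = e' * (e * (1 - e)) by ring.
  have -> : (1 - e) * e' * e = e' * (e * (1 - e)) by ring.
  rewrite !z addr0 add0r -scalerDl; apply: annE.
  have -> : e * (e * ((k == l)%:R * e)) + (1 - e) * e' * ((1 - e) * e' * ((k == l)%:R * e'))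
     - (k == l)%:R * (e + (1 - e) * e') =
     ((k == l)%:R * (e + 1 + e' ^+ 3)) * (e ^+ 2 - e) +
     ((k == l)%:R * (1 - e) * (e' + 1)) * (e' ^+ 2 - e') by ring.
  by apply: ID; exact: IM.
- have [f [g [s [ms fg]]]] := loc m mm Im.
  exists s; split=> // c; exists f.
  exists (fun k => GRing.Linear.clone _ _ _ _ (c \*: g k) _) => k l x /=.
  by rewrite (lin_scale (f k)) fg scalerA; congr (_ *: _); ring.
exists f, g => k l x; rewrite fg; apply: annE.
have -> : (k == l)%:R * u - (k == l)%:R = - (k == l)%:R * (1 - u) by ring.
exact: IM.
Qed.

(* Among the annihilators of elements that lie in [m], a maximal one, [ann x],
   becomes [m] after multiplying [x] by some element outside [m]. *)
Lemma maximal_associated Q m : finitely_generated Q -> maximal_ideal m ->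
  (exists2 d, annihilator Q d & d != 0) -> annihilator Q `<=` m ->
  exists x : Q, forall a : R, m a <-> a *: x = 0.
Proof.
move=> [n [g gP]] mm [d Id d0] Im; have [[m0 mD mM] m1 _] := mm.
pose ann (x : Q) : set R := [set a | a *: x = 0].
have ann_ideal x : is_ideal (ann x).
  split=> [|a b ha hb|a b hb]; rewrite /ann /=; first exact: scale0r.
    by rewrite scalerDl ha hb addr0.
  by rewrite -scalerA hb scaler0.
have prod_notin k (b : 'I_k -> R) : (forall i, ~ m (b i)) -> ~ m (\prod_i b i).
  move=> mb; elim/big_ind: _ => // x y mx my.
  by move=> /(maximal_idealM mm)[].
(* Otherwise every generator is killed by an element outside [m], and the product of these elements
   annihilates [Q], hence lies in [m]. *)
have [i gi] : exists i, ann (g i) `<=` m.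
  apply: contrapT => h.
  have /choice[b bP] : forall i, exists b, ann (g i) b /\ ~ m b.
    move=> i; apply: contrapT => hi; apply: h; exists i => b bg.
    by apply: contrapT => mb; apply: hi; exists b.
  apply: (prod_notin _ b) => [i|]; first by have [] := bP i.
  apply: Im => x; have [c ->] := gP x; rewrite scaler_sumr big1 // => i _.
  have [bg _] := bP i; rewrite scalerA mulrC (bigD1 i) //= mulrCA mulrC -scalerA.
  by rewrite (bg : b i *: g i = 0) scaler0.
have [||_ [[x Im' <-] xmax]] := @noetherian_max _
    [set ann x | x in [set x | ann x `<=` m]] (dedekind_noetherian R_dedekind).
- by exists (ann (g i)), (g i).
- by move=> _ [x _ <-].
(* If no such [s] exists, maximality gives [ann (r *: x) = ann x], so powers of [r] cancel on [x].
   As some [r^k (1 - c r)] annihilates [Q], [1 - c r] kills [x] and lies in [m] along with [r]. *)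
have kill r : m r -> exists s, ~ m s /\ (s * r) *: x = 0.
  move=> mr; apply: contrapT => h.
  have rm : ann (r *: x) `<=` m.
    move=> a ha; apply: contrapT => ma; apply: h; exists a; split=> //.
    by rewrite -scalerA.
  have rE : ann (r *: x) = ann x.
    apply: xmax; first by exists (r *: x).
    by move=> a ax; rewrite /ann /= scalerA mulrC -scalerA ax scaler0.
  have [k [c kc]] := pi_regular R_dedekind r (annihilator_ideal Q) Id d0.
  have cancel_r j a : (a * r ^+ j) *: x = 0 -> a *: x = 0.
    elim: j => [|j IH]; first by rewrite expr0 mulr1.
    rewrite exprS mulrCA mulrC -scalerA => ha; apply: IH.
    suff : ann x (a * r ^+ j) by [].
    by rewrite -rE.
  have : m (1 - c * r).
    apply: Im'; apply: (cancel_r k); rewrite -[RHS](kc x); congr (_ *: _).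
    by rewrite exprS; ring.
  move=> /mD/(_ (mM c r mr)); rewrite subrK; exact: m1.
have [k [h [mh hP]]] := dedekind_noetherian R_dedekind (And3 m0 mD mM).
have /choice[s sP] := fun j => kill _ (mh j).
(* [m] is finitely generated, so one multiplier outside [m] handles all of its generators. *)
exists ((\prod_j s j) *: x) => a; split.
  move=> /hP[c ->]; rewrite scaler_suml big1 // => j _.
  have [_ sh] := sP j; rewrite scalerA (bigD1 j) //=.
  set b := \prod_(_ | _) _.
  have -> : c j * h j * (s j * b) = (c j * b) * (s j * h j) by ring.
  by rewrite -scalerA sh scaler0.
rewrite scalerA => /Im' /(maximal_idealM mm)[//|].
by move=> /(prod_notin _ s)[] => j; have [] := sP j.
Qed.

End Annihilators.

Section Torsion.
Variable R : idomainType.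
Implicit Types M N : lmodType R.

Lemma torsion_map M N (f : {linear M -> N}) :
  exists F : {linear torsion M -> torsion N},
    forall x, submodule_val (F x) = f (submodule_val x).
Proof.
have fT (x : torsion M) : f (submodule_val x) \in torsion_submodClosed N.
  have /torsionP[a a0 ax] := submodule_mem x.
  by apply/torsionP; exists a => //; rewrite -lin_scale ax linear0.
have L : linear (fun x : torsion M => f (submodule_val x)).
  by move=> a x y; rewrite -linearP.
by exists (@to_submodule _ _ _ (torsion_submodClosed N) (mk_linear L) fT).
Qed.

Lemma torsion_map_family t M N (f : 'I_t -> {linear M -> N})
    (g : 'I_t -> {linear N -> M}) s :
  (forall k l x, f k (g l x) = ((k == l)%:R * s) *: x) ->
  exists (F : 'I_t -> {linear torsion M -> torsion N})
    (G : 'I_t -> {linear torsion N -> torsion M}),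
  forall k l x, F k (G l x) = ((k == l)%:R * s) *: x.
Proof.
move=> fg; have /choice[F FE] := fun k => torsion_map (f k).
have /choice[G GE] := fun k => torsion_map (g k).
by exists F, G => k l x; apply: val_inj; rewrite /= FE GE fg.
Qed.

Lemma splits_torsion t M N : splits t M N -> splits t (torsion M) (torsion N).
Proof.
move=> [f [g fg]]; have [|F [G FG]] := @torsion_map_family t M N f g 1.
  by move=> k l x; rewrite fg mulr1.
by exists F, G => k l x; rewrite FG mulr1.
Qed.

Lemma splits_mod_torsion t M N : splits t M N ->
  splits t (mod_torsion M) (mod_torsion N).
Proof.
have qmap (U V : lmodType R) (f : {linear U -> V}) :
    exists F : {linear mod_torsion U -> mod_torsion V}, forall x,
      F (quot_proj (torsion_submodClosed U) x) = quot_proj (torsion_submodClosed V) (f x).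
  apply: quot_map => x /torsionP[a a0 ax].
  by apply/torsionP; exists a => //; rewrite -lin_scale ax linear0.
move=> [f [g fg]]; have /choice[F FE] := fun k => qmap _ _ (f k).
have /choice[G GE] := fun k => qmap _ _ (g k).
exists F, G => k l y; have [x <-] := quot_proj_surj y.
by rewrite GE FE fg -lin_scale.
Qed.

End Torsion.

(** * Necessity and sufficiency of the local and rank conditions *)

Section Main.
Variable R : idomainType.
Hypothesis R_dedekind : dedekind R.
Implicit Types M N P : lmodType R.

Definition rank_condition t M N := [\/ rank N = 0%N, (1 + t * rank N <= rank M)%N |
  [/\ rank M = (t * rank N)%N, (t <= t * rank N)%N &
      steinitz_class M = (steinitz_class N ^+ t)%g]].

(** If [N] has positive rank, the complement [C] of the power of [mod_torsion N] in [mod_torsion M]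
    separates the cases: [C = 0] gives equality of ranks and classes, and otherwise [C] has rank at
    least 1. *)
Lemma splits_rank_condition t M N : (0 < t)%N -> finitely_generated M ->
  finitely_generated N -> splits t M N -> rank_condition t M N.
Proof.
case: t => // t _ fgM fgN /splits_mod_torsion/splits_complement[C [j [ji MC]]].
case: (mod_torsion_rank_class R_dedekind fgN) => [/rank_torsion|[n [c Nc]]].
  by constructor 1.
have rN := rank_class_rank Nc.
have Nt := rank_class_pow R_dedekind t Nc.
have [k [f fi]] := mod_torsion_embedding fgM.
have jf : injective (GRing.Linear.clone _ _ _ _ (f \o j) _) by exact: inj_comp.
case: (submodule_free_decomposition R_dedekind jf) => [C0|[n' [c' Cc]]].
  have Mc : rank_class (mod_torsion M) (t.+1 * n.+1).-1 (c ^+ t.+1)%g.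
    apply: rank_class_iso Nt; apply: iso_sym.
    exact: iso_trans MC (iso_prod0r _ C0).
  constructor 3; split.
  - by rewrite (rank_class_rank Mc) rN prednK.
  - by rewrite rN leq_pmulr.
  by rewrite (rank_class_steinitz Mc) (rank_class_steinitz Nc).
have Mc := rank_class_iso (iso_sym MC) (rank_class_prod R_dedekind Nt Cc).
constructor 2; rewrite (rank_class_rank Mc) rN add1n ltnS.
by rewrite -addSn prednK // leq_addr.
Qed.

Lemma rank_condition_splits t M N : (0 < t)%N -> finitely_generated M ->
  finitely_generated N -> rank_condition t M N ->
  splits t (mod_torsion M) (mod_torsion N).
Proof.
case: t => // t _ fgM fgN.
case: (mod_torsion_rank_class R_dedekind fgN) => [N0 _|[n [c Nc]]].
  exact: splits0.
have rN := rank_class_rank Nc; rewrite /rank_condition rN.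
have Nt := rank_class_pow R_dedekind t Nc.
case: (mod_torsion_rank_class R_dedekind fgM) => [/rank_torsion rM|[m [d Md]]].
  by rewrite rM => -[|//|[]//].
have rM := rank_class_rank Md; rewrite rM => -[//|nm|[mn _ dc]].
  have [I [nzI [_ cI]]] := Nt.
  have [J [nzJ IJ]] := ideal_class_inv R_dedekind nzI.
  have [L [nzL [_ dL]]] := Md.
  have [L' [nzL' [_ L'E]]] := iso_ideal_prod R_dedekind nzJ nzL.
  (* The complement must have the class of [M] times the inverse of the power of the class of [N];
     [L'] has it. As [M] has rank [m + 1], [L'] takes up the one rank left besides the free part. *)
  apply: (@complement_splits _ _ _ _
    ({ffun 'I_(m - t.+1 * n.+1) -> R^o} * submodule L')%type).
  apply: rank_class_inj Md _.
  have := rank_class_prod R_dedekind Nt (rank_class_ideal (m - t.+1 * n.+1) nzL').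
  rewrite L'E mulgA cI IJ mul1g -dL -addSn prednK // subnKC //.
apply: (@complement_splits _ _ _ _ {ffun 'I_0 -> R^o}).
apply: iso_trans (iso_sym (iso_prod0r _ (@ffun_ord0 _ _))).
apply: (rank_class_inj Md).
have -> : d = (c ^+ t.+1)%g.
  by rewrite -(rank_class_steinitz Md) dc (rank_class_steinitz Nc).
by have -> : m = (t.+1 * n.+1).-1 by rewrite -mn.
Qed.

Lemma maximal_prime_idealr (m : set R) : maximal_ideal m ->
  exists p : prime_idealr R, forall a, (a \in p) = `[< m a >].
Proof.
move=> mm; have [[m0 mD mM] m1 _] := mm.
pose p a := `[< m a >].
have h1 : idealr_closed p.
  split; first exact/asboolP.
    by apply/negP => /asboolP.
  by move=> a u v /asboolP mu /asboolP mv; apply/asboolP/mD => //; exact: mM.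
have h2 : prime_idealr_closed p.
  by move=> u v /asboolP/(maximal_idealM mm)[?|?]; apply/orP; [left|right]; exact/asboolP.
pose P : prime_idealr R := HB.pack p (isIdealr.Build R p h1) (isPrimeIdealrClosed.Build R p h2).
by exists P.
Qed.

(** A maximal ideal above the annihilator of the torsion of [N] is the annihilator of a torsion
    element, and is nonzero because it contains [d]; so a splitting is available there. Its lift to
    [M] and [N] restricts to the torsion submodules. *)
Lemma splits_torsion_local t M N : finitely_generated M -> finitely_generated N ->
  (forall m : prime_idealr R, Ass N m /\ ~ (m =i pred1 0) ->
    splits t (locmod_at m M) (locmod_at m N)) ->
  splits t (torsion M) (torsion N).
Proof.
move=> fgM fgN loc.
have fgT : finitely_generated (torsion N).
  have /isomorphicP[f [g [fK gK]]] := torsion_decomposition R_dedekind fgN.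
  have L : linear (fun x => (f x).1) by move=> a x y; rewrite linearP.
  by apply: (fg_surj (f := mk_linear L)) fgN => y; exists (g (y, 0)); rewrite /= gK.
have [d Id d0] := torsion_annihilator fgT.
apply: (splits_glue R_dedekind Id d0) => m mm Im.
have [x xE] := maximal_associated R_dedekind fgT mm (ex_intro2 _ _ d Id d0) Im.
have [p pE] := maximal_prime_idealr mm.
have pN : Ass N p.
  exists (submodule_val x) => a; rewrite pE; apply/asboolP/eqP.
    by move=> /xE ax; rewrite -[LHS]/(submodule_val (a *: x)) ax.
  by move=> ax; apply/xE/val_inj.
have p0 : ~ (p =i pred1 0).
  by move=> /(_ d); rewrite pE inE (negPf d0) => /asboolP; apply; exact: Im.
have rel (P : lmodType R) :
    finitely_generated P -> forall k (g : 'I_k -> P), finitely_related g.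
  by move=> _ k g; exact: finite_relations.
have [f [g [s fg]]] := splits_lift fgM fgN rel (loc p (conj pN p0)).
have [F [G FG]] := torsion_map_family fg.
exists F, G, (den s); split=> // ms.
have : den s \notin p := den_mem s.
by rewrite pE => /asboolP.
Qed.

End Main.

Theorem proposition7p5 (R : idomainType) (R_dedekind : dedekind R)
    (M N : lmodType R) (M_fg : finitely_generated M) (N_fg : finitely_generated N)
    (t : nat) (t_gt0 : (0 < t)%N) :
  let X (m : prime_idealr R) := Ass N m /\ ~ (m =i pred1 0) in
  let condition1 := rank N = 0%N in
  let condition2 := (1 + t * rank N <= rank M)%N in
  let condition3 :=
    [/\ rank M = (t * rank N)%N, (t <= t * rank N)%N &
        steinitz_class M = (steinitz_class N ^+ t)%g] in
  ((t%:Z%:E <= spl M N)%E <->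
     (forall m : prime_idealr R, X m ->
        (t%:Z%:E <= spl (locmod_at m M) (locmod_at m N))%E) /\
     [\/ condition1, condition2 | condition3]) /\
  ((t%:Z%:E <= spl M N)%E -> condition3 ->
     (t%:Z%:E <= spl (torsion M) (torsion N))%E /\ spl M N = t%:Z%:E).
Proof.
move=> X condition1 condition2 condition3; split; first split.
- move=> /splP MN; split; last exact: splits_rank_condition.
  by move=> m _; apply/splP; exact: splits_localize.
- move=> [loc cond]; apply/splP.
  apply: splits_iso (iso_sym (torsion_decomposition R_dedekind M_fg))
    (iso_sym (torsion_decomposition R_dedekind N_fg)) _.
  apply: splits_prod; last exact: rank_condition_splits.
  by apply: splits_torsion_local => // m Xm; apply/splP; exact: loc.
move=> /splP MN [rM tN _]; split; first by apply/splP; exact: splits_torsion.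
have N0 : (0 < rank N)%N.
  by move: tN; case: (rank N) => //; rewrite muln0 leqNgt t_gt0.
(* A splitting with exponent [t + 1] would satisfy a rank condition too, but [rank M = t * rank N]
   is less than [(t + 1) * rank N] as soon as [rank N] is positive. *)
apply: spl_eq MN _ => /(splits_rank_condition R_dedekind (ltn0Sn t) M_fg N_fg).
have lt_rank : (rank M < t.+1 * rank N)%N.
  by rewrite rM mulSn -[X in (X < _)%N]add0n ltn_add2r.
case=> [rN|/ltnW|[rE _ _]].
- by rewrite rN in N0.
- by rewrite leqNgt lt_rank.
by rewrite rE ltnn in lt_rank.
Qed.
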